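(* Each of the two spaces $Y(c_0,\ell_1,T,(2^n)_{n=1}^\infty)$ and $Y(c_0,d_{w,1},T,(2^n)_{n=1}^\infty)$ admits an equivalent $2R$ norm for which its basis $(e_n)_{n=1}^\infty$ is $1$-symmetric.
   Context: A basis $(e_n)$ is $1$-symmetric if $\|\sum_n \pm a_{\sigma(n)} e_n\|\le \|\sum_n a_n e_n\|$ for all scalars $(a_n)$, all signs and all permutations $\sigma$ of $\mathbb{N}$. It is $1$-unconditional if $\|\sum_n\pm a_ne_n\|\le\|\sum_n a_ne_n\|$ for all scalars and signs. A norm $\|\cdot\|$ on a Banach space $X$ is $2$-rotund ($2R$) if for every sequence $(x_n)\subset X$ with $\|x_n\|\le 1$ for all $n$ and $\lim_{m,n\to\infty}\|x_m+x_n\|=2$ there is $x\in X$ with $x_n\to x$ in norm. Construction of $Y(c_0,F,X,(m_n))$. Let $F$ be a Banach sequence space for which the unit vectors $(e_n)$ form a $1$-symmetric basis, with $\|x\|_\infty\le\|x\|_F$ for all $x\in F$ and $\lim_{n}\|\sum_{i=1}^n e_i\|_\infty/\|\sum_{i=1}^n e_i\|_F=0$. For $m\ge1$ and $x\in c_0$ put $$\|x\|_m=\inf\Bigl\{(\|y\|_\infty^2+\|z\|_F^2)^{1/2} : x=\tfrac1m y+mz,\ y\in c_0,\ z\in F\Bigr\},$$ which is a norm on $c_0$ equivalent to $\|\cdot\|_\infty$. Let $X$ be a Banach space with a normalized $1$-unconditional basis $(f_n)$ and let $(m_n)$ be strictly increasing with $\sum_n 1/m_n<\infty$. Then $Y(c_0,F,X,(m_n)_{n=1}^\infty)$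 is the space of all $x\in c_0$ such that $\sum_n\|x\|_{m_n}f_n$ converges in $X$, with norm $\|x\|_Y=\|\sum_{n=1}^\infty\|x\|_{m_n}f_n\|_X$. The unit vectors $(e_n)$ form a $1$-symmetric basis of this space. $d_{w,1}$ is the Lorentz sequence space with weight $w=(1/n)_{n\ge1}$: the space of null sequences $(a_n)$ with $\|(a_n)\|=\sum_{n=1}^\infty a_n^*/n<\infty$, where $(a_n^* )$ is the non-increasing rearrangement of $(|a_n|)$. $T$ is the Figiel–Johnson space (the dual of Tsirelson's original space): the completion of the space $c_{00}$ of finitely supported sequences under the unique norm satisfying $$\|x\|=\max\Bigl\{\|x\|_\infty,\ \tfrac12\sup\sum_{j=1}^k\|x\cdot 1_{(p_j,p_{j+1}]}\|\Bigr\},$$ the supremum being over all $k\ge 1$ and integers $k\le p_1<p_2<\dots<p_{k+1}$, where $x\cdot 1_{(p,q]}$ is the restriction of $x$ to coordinates $p<i\le q$. Its unit vector basis, which is normalized and $1$-unconditional, is used as $(f_n)$. *)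

(* Defs.v *)
(* Scalars are real.  Sequences, coordinates and bases are
   numbered from 0: the i-th entry here is the (i+1)-st one of the usual
   1-based numbering. *)
From HB Require Import structures.
From mathcomp Require Import all_boot all_order all_algebra.
From mathcomp Require Import all_classical all_reals all_analysis.
Set Implicit Arguments.
Unset Strict Implicit.
Unset Printing Implicit Defensive.
Import Order.TTheory GRing.Theory Num.Theory.
Import numFieldNormedType.Exports.
Local Open Scope classical_set_scope.
Local Open Scope ring_scope.

(* A normed space is a linear subspace [V] of a vector space [E] together with
   a function [p : E -> R] whose values matter only on [V]; this allows several
   norms on the same space. *)

Definition linear_subspace (R : realType) (E : lmodType R) (V : set E) : Prop :=
  V 0 /\ forall (a : R) (x y : E), V x -> V y -> V (a *: x + y).

Definition norm_on (R : realType) (E : lmodType R) (V : set E) (p : E -> R) :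
    Prop :=
  [/\ linear_subspace V,
      forall x, V x -> 0 <= p x,
      forall x, V x -> p x = 0 -> x = 0,
      forall (a : R) x, V x -> p (a *: x) = `|a| * p x &
      forall x y, V x -> V y -> p (x + y) <= p x + p y].

Definition equivalent_norms (R : realType) (E : lmodType R) (V : set E)
    (p q : E -> R) : Prop :=
  exists c C : R, [/\ 0 < c, 0 < C &
    forall x, V x -> c * p x <= q x /\ q x <= C * p x].

Definition norm_cvg (R : realType) (E : lmodType R) (p : E -> R)
    (u : nat -> E) (x : E) : Prop :=
  p (u n - x) @[n --> \oo] --> (0 : R).

Definition two_rotund (R : realType) (E : lmodType R) (V : set E)
    (p : E -> R) : Prop :=
  forall u : nat -> E,
    (forall n, V (u n)) -> (forall n, p (u n) <= 1) ->
    p (u mn.1 + u mn.2) @[mn --> (\oo, \oo)] --> (2 : R) ->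
    exists2 x, V x & norm_cvg p u x.

(* x = \sum_n a_n e_n, the series converging in (V, p) *)
Definition expansion (R : realType) (E : lmodType R) (V : set E) (p : E -> R)
    (e : nat -> E) (a : nat -> R) (x : E) : Prop :=
  V x /\ norm_cvg p (series (fun n => a n *: e n)) x.

Definition schauder_basis (R : realType) (E : lmodType R) (V : set E)
    (p : E -> R) (e : nat -> E) : Prop :=
  (forall n, V (e n)) /\
  forall x, V x -> exists! a : nat -> R, expansion V p e a x.

Definition one_symmetric_basis (R : realType) (E : lmodType R) (V : set E)
    (p : E -> R) (e : nat -> E) : Prop :=
  schauder_basis V p e /\
  forall (a : nat -> R) (eps : nat -> bool) (sigma : nat -> nat) (x : E),
    bijective sigma -> expansion V p e a x ->
    exists2 y, expansion V p e (fun n => (-1) ^+ eps n * a (sigma n)) y &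
               p y <= p x.

Definition is_completion (R : realType) (E : lmodType R) (V : set E)
    (p : E -> R) (T : completeNormedModType R) (iota : E -> T) : Prop :=
  [/\ forall (a : R) x y, V x -> V y ->
        iota (a *: x + y) = a *: iota x + iota y,
      forall x, V x -> `|iota x| = p x &
      dense (iota @` V)].

Definition unit_vec (R : realType) (n : nat) : nat -> R :=
  fun i => (i == n)%:R.

Definition c00 (R : realType) : set (nat -> R) :=
  [set x | finite_set [set i | x i != 0]].

Definition c0 (R : realType) : set (nat -> R) :=
  [set x | x n @[n --> \oo] --> (0 : R)].

Definition sup_norm (R : realType) (x : nat -> R) : R :=
  sup (range (fun i => `|x i|)).

Definition ell1 (R : realType) : set (nat -> R) :=
  [set x | cvgn (series (fun n => `|x n|) : nat -> R)].

Definition ell1_norm (R : realType) (x : nat -> R) : R :=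
  limn (series (fun n => `|x n|) : nat -> R).

(* The non-increasing rearrangement of |x|, as the generalized inverse of the
   distribution function t |-> #{i : |x_i| > t}. *)
Definition decr_rearr (R : realType) (x : nat -> R) (n : nat) : R :=
  inf [set t : R | 0 <= t /\ ([set i | t < `|x i|] #<= `I_n)%card].

(* Lorentz space d_{w,1} with weight w = (1, 1/2, 1/3, ...) *)
Definition lorentz (R : realType) : set (nat -> R) :=
  [set x | c0 x /\ cvgn (series (fun n => decr_rearr x n / n.+1%:R) : nat -> R)].

Definition lorentz_norm (R : realType) (x : nat -> R) : R :=
  limn (series (fun n => decr_rearr x n / n.+1%:R) : nat -> R).

(* With 1-based coordinates this is the restriction to (p, q]. *)
Definition restr (R : realType) (p q : nat) (x : nat -> R) : nat -> R :=
  fun i => if (p <= i < q)%N then x i else 0.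

(* [p 0 < ... < p k] stands for p_1 < ... < p_{k+1}.  For x in c00 the set of
   sums is bounded, as only finitely many restrictions of x occur and at most
   #supp x of them in one sum are nonzero. *)
Definition figiel_johnson_sums (R : realType) (N : (nat -> R) -> R)
    (x : nat -> R) : set R :=
  [set s | exists (k : nat) (p : nat -> nat),
     [/\ (1 <= k)%N, (k <= p 0)%N, forall j, (j < k)%N -> (p j < p j.+1)%N &
         s = \sum_(j < k) N (restr (p j) (p j.+1) x)]].

Definition figiel_johnson_norm (R : realType) (N : (nat -> R) -> R) : Prop :=
  norm_on (@c00 R) N /\
  forall x, c00 x ->
    N x = Num.max (sup_norm x) (2^-1 * sup (figiel_johnson_sums N x)).

(* ||x||_m for a sequence space F with norm pF; used only for x in c0 and
   m >= 1, where the infimum is over a nonempty set. *)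
Definition interp_norm (R : realType) (F : set (nat -> R))
    (pF : (nat -> R) -> R) (m : nat) (x : nat -> R) : R :=
  inf [set r : R | exists y z : nat -> R,
        [/\ c0 y, F z, x = m%:R^-1 *: y + m%:R *: z &
            r = Num.sqrt (sup_norm y ^+ 2 + pF z ^+ 2)]].

Definition Y_series (R : realType) (F : set (nat -> R))
    (pF : (nat -> R) -> R) (X : completeNormedModType R) (f : nat -> X)
    (m : nat -> nat) (x : nat -> R) : nat -> X :=
  series (fun n => interp_norm F pF (m n) x *: f n).

Definition Y_space (R : realType) (F : set (nat -> R))
    (pF : (nat -> R) -> R) (X : completeNormedModType R) (f : nat -> X)
    (m : nat -> nat) : set (nat -> R) :=
  [set x | c0 x /\ cvgn (Y_series F pF f m x)].

Definition Y_norm (R : realType) (F : set (nat -> R))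
    (pF : (nat -> R) -> R) (X : completeNormedModType R) (f : nat -> X)
    (m : nat -> nat) (x : nat -> R) : R :=
  `|limn (Y_series F pF f m x)|.

Definition has_symmetric_2R_renorming (R : realType) (V : set (nat -> R))
    (p : (nat -> R) -> R) : Prop :=
  exists q : (nat -> R) -> R,
    [/\ norm_on V q, equivalent_norms V p q, two_rotund V q &
        one_symmetric_basis V q (@unit_vec R)].

(* Main.v *)
(* Let [a x] be the sequence of the interpolation norms of [x].  As the basis of
   [T] is boundedly complete, [Y] consists of the null sequences [x] for which
   the sections of [a x] are bounded in the Figiel-Johnson norm, and
   [P x = ||a x||_T] is the norm of [Y].  The new norm is the square root of a
   weighted sum of squares of countably many symmetric seminorms dominated by
   [P]; hence ||u_m + u_n|| -> 2 in the unit ball forces each of them, [p] say,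
   to satisfy [2 p(u_m)^2 + 2 p(u_n)^2 - p(u_m + u_n)^2 -> 0].  There are two
   kinds of seminorms.

   - The l_2 norms of the [l] largest coordinates.  Since the interpolation norm
     of a sum of many unit vectors is about [m], a bounded set of [Y] has
     uniformly few coordinates above a given level, and these seminorms make
     [u_n] a Cauchy sequence for the sup norm.

   - [|| tail k (a x) + P x *: c ||_T] for rational [c >= 0], in the spirit of
     Odell and Schlumprecht's 2R renorming of separable reflexive spaces; as
     everything is nonnegative, monotonicity of the norm of [T] keeps these
     functions convex.  If the tails [v_n = tail k (a u_n)] did not become
     uniformly small, one would get [||b + s v_m + t v_n|| ~ ||b + (s + t) v_n||]
     for all [b >= 0], and inductively a finite block [u_0] and blocks
     [u_1 < ... < u_r] after it, with [r] large with respect to the support of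
     [u_0], such that [u_0 + (u_1 + ... + u_r) / r] has almost the norm [2 L],
     all blocks having norm about [L].  In [T] that norm is at most about
     [3 L / 2].

   Uniformly small tails and convergence for the sup norm give convergence
   in [Y]. *)
Require Import Defs.
From HB Require Import structures.
From mathcomp Require Import all_boot all_order all_algebra.
From mathcomp Require Import all_classical all_reals all_analysis.
From mathcomp Require Import ring lra zify.
Set Implicit Arguments.
Unset Strict Implicit.
Unset Printing Implicit Defensive.
Import Order.TTheory GRing.Theory Num.Theory.
Import numFieldNormedType.Exports.
Local Open Scope classical_set_scope.
Local Open Scope ring_scope.

(** * The Figiel-Johnson norm on finitely supported sequences *)

Section finite_support.
Context {R : realType}.
Implicit Types (x y : nat -> R) (i p q K : nat).

Lemma c00P x : c00 x <-> exists K, forall i, (K <= i)%N -> x i = 0.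
Proof.
split=> [|[K xK]].
  move=> /finite_seqP[s xs]; exists (\max_(i <- s) i.+1)%N => i si.
  apply/eqP/negPn/negP => xi.
  have /= : [set` s] i by rewrite -xs.
  move=> /= ins; have := @leq_bigmax_seq _ s predT S i ins erefl.
  by rewrite ltnNge si.
apply: (@sub_finite_set _ _ `I_K); last exact: finite_II.
move=> i /= /eqP xi; rewrite ltnNge; apply/negP => /xK; exact: xi.
Qed.

Lemma c00D x y : c00 x -> c00 y -> c00 (x + y).
Proof.
move=> /c00P[K xK] /c00P[L yL]; apply/c00P; exists (maxn K L) => i.
by rewrite geq_max => /andP[/xK + /yL]; rewrite !fctE => -> ->; rewrite addr0.
Qed.

Lemma c00Z (a : R) x : c00 x -> c00 (a *: x).
Proof.
by move=> /c00P[K xK]; apply/c00P; exists K => i /xK; rewrite !fctE => ->; rewrite scaler0.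
Qed.

Lemma c00_restr p q x : c00 (restr p q x).
Proof.
apply/c00P; exists q => i qi; rewrite /restr.
by rewrite [(i < q)%N]ltnNge qi andbF.
Qed.

Lemma c00_dom x y : c00 y -> (forall i, `|x i| <= `|y i|) -> c00 x.
Proof.
move=> /c00P[K yK] xy; apply/c00P; exists K => i /yK yi.
by have := xy i; rewrite yi normr0 normr_le0 => /eqP.
Qed.

Lemma restrE p q x i : restr p q x i = (p <= i < q)%N%:R * x i.
Proof. by rewrite /restr; case: ifP => _; rewrite ?mul1r ?mul0r. Qed.

Lemma restrD p q x y : restr p q (x + y) = restr p q x + restr p q y.
Proof. by apply/funext => i; rewrite !fctE /restr; case: ifP; rewrite ?addr0. Qed.

Lemma restrZ p q (a : R) x : restr p q (a *: x) = a *: restr p q x.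
Proof. by apply/funext => i; rewrite !fctE /restr; case: ifP; rewrite ?scaler0. Qed.

Lemma restr_sum p q n (x : 'I_n -> nat -> R) :
  restr p q (\sum_(j < n) x j) = \sum_(j < n) restr p q (x j).
Proof.
apply/funext => i; rewrite restrE !fct_sumE mulr_sumr.
by apply: eq_bigr => j _; rewrite restrE.
Qed.

Lemma ler_norm_restr p q x i : `|restr p q x i| <= `|x i|.
Proof. by rewrite /restr; case: ifP => //; rewrite normr0. Qed.

Lemma restr_id p q x : (forall i, ~~ (p <= i < q)%N -> x i = 0) ->
  restr p q x = x.
Proof. by move=> xpq; apply/funext => i; rewrite /restr; case: ifPn => // /xpq. Qed.

Lemma restr_restr p q p' q' x :
  restr p q (restr p' q' x) = restr (maxn p p') (minn q q') x.
Proof.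
apply/funext => i; rewrite /restr geq_max leq_min.
by case: (p <= i)%N; case: (p' <= i)%N; case: (i < q)%N; case: (i < q')%N.
Qed.

Lemma restr_geq p q x : (q <= p)%N -> restr p q x = 0.
Proof.
move=> qp; apply/funext => i; rewrite /restr; case: ifP => // /andP[pi].
by rewrite ltnNge (leq_trans qp pi).
Qed.

Lemma incr_leq k (p : nat -> nat) : (forall j, (j < k)%N -> (p j < p j.+1)%N) ->
  forall i j, (i <= j <= k)%N -> (p i <= p j)%N.
Proof.
move=> pS i; elim=> [|j IH] /andP[ij jk]; first by move: ij; rewrite leqn0 => /eqP ->.
move: ij; rewrite leq_eqVlt => /orP[/eqP->//|ij].
by apply: leq_trans (ltnW (pS _ jk)); apply: IH; rewrite -ltnS ij ltnW.
Qed.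

Lemma sum_restr k (p : nat -> nat) x i :
  (forall j, (j < k)%N -> (p j < p j.+1)%N) ->
  \sum_(j < k) restr (p j) (p j.+1) x i = restr (p 0) (p k) x i.
Proof.
elim: k => [|k IH] pk; first by rewrite big_ord0 /restr ltnNge andbN.
rewrite big_ord_recr /= IH => [|j jk]; last exact/pk/ltnW.
have p0k : (p 0 <= p k)%N.
  by apply: (incr_leq pk); rewrite leqnSn.
have pkk := pk k (ltnSn k).
rewrite /restr.
case: (ltnP i (p k)) => ik.
  by rewrite (leq_trans ik (ltnW pkk)) andbT addr0.
by rewrite (leq_trans p0k ik) andbF add0r.
Qed.

Lemma c00_unit i : c00 (unit_vec R i).
Proof.
by apply/c00P; exists i.+1 => j ij; rewrite /unit_vec eqn_leq [(j <= i)%N]leqNgt ij.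
Qed.

End finite_support.

Section fj_norm.
Context {R : realType} {N : (nat -> R) -> R}.
Hypothesis hN : figiel_johnson_norm N.
Implicit Types (x y : nat -> R) (i p q K : nat).

Let normN : norm_on (@c00 R) N := hN.1.

Lemma fj_ge0 x : c00 x -> 0 <= N x.
Proof. by case: normN => _ + _ _ _; apply. Qed.

Lemma fjZ (a : R) x : c00 x -> N (a *: x) = `|a| * N x.
Proof. by case: normN => _ _ _ + _; apply. Qed.

Lemma fjD x y : c00 x -> c00 y -> N (x + y) <= N x + N y.
Proof. by case: normN => _ _ _ _; apply. Qed.

Lemma fj0 : N 0 = 0.
Proof.
have c0 : c00 (0 : nat -> R) by apply/c00P; exists 0%N.
by rewrite -(scale0r (0 : nat -> R)) fjZ // normr0 mul0r.
Qed.

Lemma fj_sum n (x : 'I_n -> nat -> R) : (forall j, c00 (x j)) ->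
  N (\sum_(j < n) x j) <= \sum_(j < n) N (x j).
Proof.
move=> cx.
suff [] : c00 (\sum_(j < n) x j) /\ N (\sum_(j < n) x j) <= \sum_(j < n) N (x j) by [].
elim/big_ind2 : _ => [|x1 x2 y1 y2 [cx2 h] [cy2 h']|//].
  by split; [apply/c00P; exists 0%N|rewrite fj0].
by split; [exact: c00D|apply: le_trans (fjD _ _) _ => //; exact: lerD].
Qed.

Lemma fj_le_coords K x :
  N (restr 0 K x) <= \sum_(i < K) `|x i| * N (unit_vec R i).
Proof.
have -> : restr 0 K x = \sum_(i < K) x i *: unit_vec R i.
  apply/funext => j; rewrite fct_sumE /restr /=.
  case: ltnP => jK.
    rewrite (bigD1 (Ordinal jK)) //= fctE /unit_vec eqxx [_ *: _]mulr1.
    rewrite big1 ?addr0 // => i /negPf ij; rewrite fctE.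
    by rewrite [j == _]eq_sym (_ : (_ == j) = false) ?scaler0.
  rewrite big1 // => i _; rewrite fctE /unit_vec gtn_eqF ?scaler0 //.
  exact: leq_trans (ltn_ord i) jK.
apply: le_trans (fj_sum _) _ => [j|]; first exact/c00Z/c00_unit.
by apply: ler_sum => i _; rewrite fjZ //; exact: c00_unit.
Qed.

Lemma fj_sums_ubound x : c00 x -> has_ubound (figiel_johnson_sums N x).
Proof.
move=> /c00P[K xK].
exists (\sum_(i < K) `|x i| * N (unit_vec R i)) => _ [k [p [k1 kp pS ->]]].
apply: (@le_trans _ _ (\sum_(j < k) \sum_(i < K)
    `|restr (p j) (p j.+1) x i| * N (unit_vec R i))).
  apply: ler_sum => j _.
  rewrite -[X in N X](@restr_id _ 0 K) ?fj_le_coords // => i /=.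
  by rewrite -leqNgt => /xK xi; rewrite /restr xi if_same.
rewrite exchange_big /=; apply: ler_sum => i _; rewrite -mulr_suml.
apply: ler_wpM2r; first exact/fj_ge0/c00_unit.
rewrite (eq_bigr (fun j : 'I_k => restr (p j) (p j.+1) (fun i => `|x i|) i)).
  by rewrite sum_restr // /restr; case: ifP.
by move=> j _; rewrite /restr; case: ifP; rewrite ?normr0.
Qed.

Lemma sup_norm_fin_ub x : c00 x -> has_ubound (range (fun i => `|x i|)).
Proof.
move=> /c00P[K xK]; exists (\sum_(i < K) `|x i|) => _ [i _ <-].
have [iK|/xK ->] := ltnP i K.
  by rewrite (bigD1 (Ordinal iK)) //= lerDl sumr_ge0.
by rewrite normr0 sumr_ge0.
Qed.

Lemma fj_ge_coord x i : c00 x -> `|x i| <= N x.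
Proof.
move=> cx; rewrite (hN.2 _ cx) le_max; apply/orP; left.
by apply: ub_le_sup; [exact: sup_norm_fin_ub|exists i].
Qed.

Lemma fj_ge_sums x k (p : nat -> nat) : c00 x -> (1 <= k)%N -> (k <= p 0)%N ->
  (forall j, (j < k)%N -> (p j < p j.+1)%N) ->
  \sum_(j < k) N (restr (p j) (p j.+1) x) <= 2 * N x.
Proof.
move=> cx k1 kp pS.
suff : 2^-1 * \sum_(j < k) N (restr (p j) (p j.+1) x) <= N x by lra.
rewrite [leRHS](hN.2 _ cx) le_max; apply/orP; right.
apply: ler_wpM2l; first lra.
apply: ub_le_sup; first exact: fj_sums_ubound.
by exists k, p.
Qed.

Lemma fj_le x (B : R) : c00 x -> (forall i, `|x i| <= B) ->
  (forall k (p : nat -> nat), (1 <= k)%N -> (k <= p 0)%N ->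
    (forall j, (j < k)%N -> (p j < p j.+1)%N) ->
    \sum_(j < k) N (restr (p j) (p j.+1) x) <= 2 * B) ->
  N x <= B.
Proof.
move=> cx xB sB; rewrite (hN.2 _ cx) ge_max; apply/andP; split.
  by apply: ge_sup => [|_ [i _ <-]//]; exists `|x 0%N|; exists 0%N.
suff : sup (figiel_johnson_sums N x) <= 2 * B by lra.
apply: ge_sup => [|_ [k [p [k1 kp pS ->]]]]; last exact: sB.
(* The set of sums is nonempty: one interval, with [p j = j + 1], so that [k <= p 0]. *)
by eexists; exists 1%N, S; split.
Qed.

(** Only one interval of an admissible family can contain [i], so the norm of the unit vector is at
    most the maximum of 1 and half of itself. *)
Lemma fj_unit_le1 i : N (unit_vec R i) <= 1.
Proof.
have N0 := fj_ge0 (c00_unit i).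
suff : N (unit_vec R i) <= Num.max 1 (2^-1 * N (unit_vec R i)).
  rewrite le_max => /orP[//|]; lra.
apply: fj_le => [|j|k p k1 kp pS]; first exact: c00_unit.
  by rewrite le_max /unit_vec; case: eqP => _; rewrite ?normr1 ?normr0 ?lexx ?ler01.
apply: (@le_trans _ _ (N (unit_vec R i))); last first.
  by rewrite maxr_pMr //; rewrite le_max; apply/orP; right; lra.
rewrite (eq_bigr (fun j : 'I_k => restr (p j) (p j.+1) (fun=> N (unit_vec R i)) i)).
  by rewrite sum_restr // /restr; case: ifP.
move=> j _; rewrite {2}/restr; case: ifPn => ij.
  congr N; apply: restr_id => l; rewrite /unit_vec.
  by case: eqP => // ->; rewrite ij.
rewrite (_ : restr _ _ _ = 0) ?fj0 //; apply/funext => l.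
rewrite /restr /unit_vec; case: ifPn => //; case: eqP => // ->.
by rewrite (negPf ij).
Qed.

(* Strong induction on the length of an interval containing the support of [x]:
   an admissible sum either splits the support into strictly shorter pieces, or
   has a single nonzero term, equal to [N x], and then only contributes
   [N x / 2]. *)
Lemma fj_mono x y : c00 y -> (forall i, `|x i| <= `|y i|) -> N x <= N y.
Proof.
move=> cy xy; have cx := c00_dom cy xy.
have /c00P[K xK] := cx.
suff key d : forall a u v, c00 v -> (forall i, `|u i| <= `|v i|) ->
    N (restr a (a + d) u) <= N v.
  by rewrite -(@restr_id _ 0 K x) ?(key K 0%N) // => i; rewrite leq0n -leqNgt => /xK.
elim/ltn_ind: d => d IH a u v cv uv; have N0 := fj_ge0 cv.
have [->|d0] := posnP d; first by rewrite addn0 restr_geq // fj0.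
set z := restr a (a + d) u; have cz : c00 z by exact: c00_restr.
have zv i : `|z i| <= `|v i| by exact: le_trans (ler_norm_restr _ _ _ _) _.
(* The bound involves [N z] itself, but halved: if the second argument is the larger one, then
   [N z <= 0]. *)
suff : N z <= Num.max (N v) (2^-1 * N z).
  by have := fj_ge0 cz; rewrite le_max => Nz /orP[//|]; lra.
apply: fj_le => // [i|k p k1 kp pS].
  by rewrite le_max (le_trans (zv i)) //; exact: fj_ge_coord.
have pm := incr_leq pS.
have [[j jk [pja apj]]|nE] :=
    pselect (exists2 j, (j < k)%N & (p j <= a /\ a + d <= p j.+1)%N).
  apply: (@le_trans _ _ (N z)); last first.
    by rewrite maxr_pMr //; rewrite le_max; apply/orP; right; lra.
  rewrite (bigD1 (Ordinal jk)) //= big1 ?addr0 => [|i ij].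
    by rewrite /z restr_restr (maxn_idPr pja) (minn_idPr apj).
  rewrite /z restr_restr restr_geq ?fj0 //.
  have {}ij : (i != j :> nat)%N by [].
  have := ltn_ord i; case: (ltngtP i j) ij => // ij _ ik.
    have := pm i.+1 j; rewrite ij (ltnW jk) => /(_ erefl); lia.
  have := pm j.+1 i; rewrite ij (ltnW ik) => /(_ erefl); lia.
apply: (@le_trans _ _ (2 * N v)); last by rewrite ler_pM2l // le_max lexx.
apply: le_trans (fj_ge_sums cv k1 kp pS); apply: ler_sum => j _.
(* Interval [j] does not cover the window, so its trace [[l, r)] is shorter than [d] and the
   induction hypothesis applies. *)
have {}nE : ~ (p j <= a /\ a + d <= p j.+1)%N by move=> h; apply: nE; exists j.
have vc : c00 (restr (p j) (p j.+1) v) by exact: c00_restr.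
rewrite /z restr_restr; set l := maxn _ _; set r := minn _ _.
have [rl|lr] := leqP r l; first by rewrite restr_geq // fj0 fj_ge0.
have -> : restr l r u = restr l (l + (r - l)) (restr (p j) (p j.+1) u).
  by rewrite restr_restr subnKC ?(ltnW lr) //; congr restr; rewrite /l /r; lia.
apply: IH => // [|i]; first by rewrite /l /r; lia.
by rewrite /restr; case: ifP.
Qed.

End fj_norm.

(** * Averages of successive blocks *)

Section fj_blocks.
Context {R : realType} {N : (nat -> R) -> R}.
Hypothesis hN : figiel_johnson_norm N.
Implicit Types (x y u v w : nat -> R) (i j k p q K : nat).

(* If two intervals meet, the left end of one of them lies in the other: hence
   [r] successive blocks and [k] successive intervals have at most [r + k]
   intersecting pairs. *)
Lemma fj_sum_blocks (B : R) r (K : nat -> nat) (v : nat -> nat -> R) k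
    (p : nat -> nat) :
  0 <= B -> (forall i, (i < r)%N -> (K i < K i.+1)%N) ->
  (forall i, (i < r)%N -> N (restr (K i) (K i.+1) (v i)) <= B) ->
  (forall j, (j < k)%N -> (p j < p j.+1)%N) ->
  \sum_(j < k) N (restr (p j) (p j.+1)
    (\sum_(i < r) restr (K i) (K i.+1) (v i))) <= B * (r + k)%:R.
Proof.
move=> B0 KS vB pS.
(* Restrictions of the constant 1 are indicators: the two terms below record whether block [i]
   starts in interval [j], and conversely. *)
pose one : nat -> R := fun=> 1.
have hone a b i : restr a b one i <= 1 by rewrite /restr; case: ifP.
apply: (@le_trans _ _ (\sum_(j < k) \sum_(i < r)
    B * (restr (p j) (p j.+1) one (K i) + restr (K i) (K i.+1) one (p j)))).
  apply: ler_sum => j _; rewrite restr_sum.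
  apply: le_trans (fj_sum hN _) _ => [i|]; first exact: c00_restr.
  apply: ler_sum => i _; rewrite restr_restr.
  have [ml|lm] := leqP (minn (p j.+1) (K i.+1)) (maxn (p j) (K i)).
    rewrite restr_geq // fj0 // mulr_ge0 // addr_ge0 //.
      by rewrite /restr; case: ifP.
    by rewrite /restr; case: ifP.
  apply: le_trans (_ : B <= _).
    apply: le_trans (vB i _) => //; apply: (fj_mono hN) => [|l].
      exact: c00_restr.
    by rewrite -restr_restr ler_norm_restr.
  rewrite ler_peMr //.
  have [|] := leqP (p j) (K i) => pK.
    rewrite {1}/restr pK /=; rewrite ifT; last by lia.
    by rewrite lerDl /restr; case: ifP.
  rewrite {2}/restr (ltnW pK) /=; rewrite ifT; last by lia.
  by rewrite lerDr /restr; case: ifP.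
under eq_bigr do (rewrite -mulr_sumr big_split /=).
rewrite -mulr_sumr big_split /= natrD ler_wpM2l // lerD //.
  rewrite exchange_big /= -[X in X%:R](card_ord r) -sum1_card natr_sum.
  by apply: ler_sum => i _; rewrite sum_restr.
rewrite -[X in X%:R](card_ord k) -sum1_card natr_sum.
by apply: ler_sum => j _; rewrite sum_restr.
Qed.

(** An admissible family beginning after the support of the head [restr 0 (K 0) v0] only sees the
    average, of norm at most [B]. One beginning earlier has at most [K 0] intervals: the head
    contributes at most [2 * B], the average at most [B * (1 + k / r)], and the norm equation takes
    half of the total. *)
Lemma fj_le_average (B : R) r (K : nat -> nat) (v0 : nat -> R)
    (v : nat -> nat -> R) :
  (0 < r)%N -> (forall i, (i < r)%N -> (K i < K i.+1)%N) ->
  N (restr 0 (K 0) v0) <= B ->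
  (forall i, (i < r)%N -> N (restr (K i) (K i.+1) (v i)) <= B) ->
  N (restr 0 (K 0) v0 + r%:R^-1 *: \sum_(i < r) restr (K i) (K i.+1) (v i))
    <= B * (3 / 2 + (K 0)%:R / (2 * r%:R)).
Proof.
move=> r0 KS v0B vB.
have rR : 0 < r%:R :> R by rewrite ltr0n.
have B0 : 0 <= B by apply: le_trans v0B; apply/(fj_ge0 hN)/c00_restr.
set u0 := restr 0 _ _; set s := \sum_(i < r) _; set w := _ *: s.
have cu : c00 u0 by exact: c00_restr.
have cs : c00 s.
  rewrite /s; elim/big_ind : _ => [|x y|i _]; [|exact: c00D|exact: c00_restr].
  by apply/c00P; exists 0%N.
have cw : c00 w by exact: c00Z.
have Kge i : (i <= r)%N -> (K 0 <= K i)%N by move=> ir; apply: (incr_leq KS).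
have s0 i : (i < K 0)%N -> w i = 0.
  move=> iK; rewrite /w /s fctE fct_sumE big1 ?scaler0 // => l _.
  by rewrite /restr leqNgt (leq_trans iK) // Kge // ltnW.
have wB : N w <= B.
  rewrite fjZ // gtr0_norm ?invr_gt0 // ler_pdivrMl //.
  apply: le_trans (fj_sum hN _) _ => [i|]; first exact: c00_restr.
  rewrite -[X in X%:R](card_ord r) -sum1_card natr_sum mulr_suml.
  by apply: ler_sum => i _; rewrite mul1r vB.
have b1 : B <= B * (3 / 2 + (K 0)%:R / (2 * r%:R)).
  rewrite ler_peMr // -[leLHS]addr0 lerD //; lra.
apply: fj_le => // [|i|k p k1 kp pS].
  exact: c00D.
  apply: le_trans b1; rewrite fctE.
  have [iK|Ki] := ltnP i (K 0).
    by rewrite s0 // addr0 (le_trans (fj_ge_coord hN _ cu)).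
  rewrite {1}/u0 /restr [(i < _)%N]ltnNge Ki andbF add0r.
  by rewrite (le_trans (fj_ge_coord hN _ cw)).
have pm := incr_leq pS.
have [Kp|pK] := leqP (K 0) (p 0).
  rewrite (eq_bigr (fun j : 'I_k => N (restr (p j) (p j.+1) w))); last first.
    move=> j _; congr N; rewrite restrD; apply/funext => i; rewrite fctE.
    rewrite {1}/restr; case: ifP => [/andP[pi _]|_]; last by rewrite add0r.
    have p0j : (p 0 <= p j)%N by apply: pm; rewrite (ltnW (ltn_ord j)).
    rewrite /u0 /restr [(i < K 0)%N]ltnNge.
    by rewrite (leq_trans (leq_trans Kp p0j) pi) andbF add0r.
  apply: le_trans (fj_ge_sums hN cw k1 kp pS) _.
  by rewrite ler_pM2l // (le_trans wB).
apply: (@le_trans _ _ (2 * B + r%:R^-1 * (B * (r + k)%:R))).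
  apply: (@le_trans _ _ (\sum_(j < k) (N (restr (p j) (p j.+1) u0) +
      r%:R^-1 * N (restr (p j) (p j.+1) s)))).
    apply: ler_sum => j _; rewrite restrD.
    apply: le_trans (fjD hN _ _) _; try exact: c00_restr.
    rewrite lerD2l /w restrZ fjZ //; last exact: c00_restr.
    by rewrite gtr0_norm ?invr_gt0.
  rewrite big_split /= lerD //.
    apply: le_trans (fj_ge_sums hN cu k1 kp pS) _.
    by rewrite ler_pM2l // (le_trans wB).
  rewrite -mulr_sumr ler_pM2l ?invr_gt0 //.
  exact: fj_sum_blocks.
have kK : (k%:R : R) <= (K 0)%:R by rewrite ler_nat (leq_trans kp) // ltnW.
rewrite natrD.
have -> : 2 * B + r%:R^-1 * (B * (r%:R + k%:R)) = B * (3 + k%:R / r%:R) :> R.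
  by field; rewrite gt_eqF.
have -> : 2 * (B * (3 / 2 + (K 0)%:R / (2 * r%:R))) = B * (3 + (K 0)%:R / r%:R) :> R.
  by field; rewrite gt_eqF.
by rewrite ler_wpM2l // lerD2l ler_wpM2r // invr_ge0 ltW.
Qed.

End fj_blocks.

(** * The Figiel-Johnson norm on infinite sequences *)

Section fj_extension.
Context {R : realType} {N : (nat -> R) -> R}.
Hypothesis hN : figiel_johnson_norm N.
Implicit Types (x y u v w b : nat -> R) (i j k p q K : nat).

(** Infinite sequences are handled through the norms of their initial sections. [fj_ext] is
    meaningful only under [fj_bounded], as [sup] has a default value on unbounded sets. *)
Definition fj_bounded (P : (nat -> R) -> R) v :=
  has_ubound (range (fun K => P (restr 0 K v))).

Definition fj_ext (P : (nat -> R) -> R) v : R :=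
  sup (range (fun K => P (restr 0 K v))).

Definition tail k v : nat -> R := fun i => if (k <= i)%N then v i else 0.

Lemma fj_ext_le (B : R) v : (forall K, N (restr 0 K v) <= B) ->
  fj_bounded N v /\ fj_ext N v <= B.
Proof.
move=> vB; have vU : ubound (range (fun K => N (restr 0 K v))) B by move=> _ [K _ <-].
by split; [exists B|apply: ge_sup => //; exists (N (restr 0 0 v)), 0%N].
Qed.

Lemma le_fj_ext K v : fj_bounded N v -> N (restr 0 K v) <= fj_ext N v.
Proof. by move=> vb; apply: ub_le_sup => //; exists K. Qed.

Lemma fj_ext_ge0 v : fj_bounded N v -> 0 <= fj_ext N v.
Proof.
by move=> vb; apply: le_trans (le_fj_ext 0 vb); apply/(fj_ge0 hN)/c00_restr.
Qed.

Lemma fj_ext_mono v w : fj_bounded N w -> (forall i, `|v i| <= `|w i|) ->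
  fj_bounded N v /\ fj_ext N v <= fj_ext N w.
Proof.
move=> wb vw; apply: fj_ext_le => K; apply: le_trans (le_fj_ext K wb).
apply: (fj_mono hN) => [|i]; first exact: c00_restr.
by rewrite /restr; case: ifP.
Qed.

Lemma fj_extD v w : fj_bounded N v -> fj_bounded N w ->
  fj_bounded N (v + w) /\ fj_ext N (v + w) <= fj_ext N v + fj_ext N w.
Proof.
move=> vb wb; apply: fj_ext_le => K; rewrite restrD.
apply: le_trans (fjD hN _ _) _; try exact: c00_restr.
by rewrite lerD // le_fj_ext.
Qed.

Lemma fj_extZ_le (a : R) v : fj_bounded N v ->
  fj_bounded N (a *: v) /\ fj_ext N (a *: v) <= `|a| * fj_ext N v.
Proof.
move=> vb; apply: fj_ext_le => K; rewrite restrZ.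
rewrite fjZ //; last exact: c00_restr.
by rewrite ler_wpM2l // le_fj_ext.
Qed.

Lemma fj_extZ (a : R) v : fj_bounded N v ->
  fj_ext N (a *: v) = `|a| * fj_ext N v.
Proof.
move=> vb; have [avb av] := fj_extZ_le a vb; apply/le_anti; rewrite av /=.
have [->|a0] := eqVneq a 0.
  by rewrite normr0 mul0r fj_ext_ge0 //; have [] := fj_extZ_le 0 vb.
have [_] := fj_extZ_le a^-1 avb.
by rewrite scalerA mulVf // scale1r normfV ler_pdivlMl // normr_gt0.
Qed.

Lemma fj_ext_coord v i : fj_bounded N v -> `|v i| <= fj_ext N v.
Proof.
move=> vb; apply: le_trans (le_fj_ext i.+1 vb).
apply: le_trans (fj_ge_coord hN i (c00_restr _ _ _)).
by rewrite /restr /= ltnS leqnn.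
Qed.

Lemma fj_ext_fin v : c00 v -> fj_bounded N v /\ fj_ext N v = N v.
Proof.
move=> vc.
have [vb vN] : fj_bounded N v /\ fj_ext N v <= N v.
  apply: fj_ext_le => K; apply: (fj_mono hN) => // i.
  by rewrite /restr; case: ifP; rewrite ?normr0.
split=> //; apply/le_anti; rewrite vN /=.
have /c00P[K vK] := vc; apply: le_trans (le_fj_ext K vb).
by rewrite restr_id // => i; rewrite leq0n -leqNgt => /vK.
Qed.

Lemma tailD k v w : tail k (v + w) = tail k v + tail k w.
Proof. by apply/funext => i; rewrite !fctE /tail; case: ifP; rewrite ?addr0. Qed.

Lemma ler_norm_tail k v i : `|tail k v i| <= `|v i|.
Proof. by rewrite /tail; case: ifP; rewrite ?normr0. Qed.

Lemma fj_bounded_tail k v : fj_bounded N v -> fj_bounded N (tail k v).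
Proof. by move=> vb; have [] := fj_ext_mono vb (ler_norm_tail k v). Qed.

Lemma fj_ext_split k v : fj_bounded N v ->
  fj_ext N v <= N (restr 0 k v) + fj_ext N (tail k v).
Proof.
move=> vb; have [rb <-] := fj_ext_fin (c00_restr 0 k v).
have [_ + ] := fj_extD rb (fj_bounded_tail k vb); apply: le_trans.
rewrite [leLHS](_ : _ = fj_ext N (restr 0 k v + tail k v)) //; congr fj_ext.
apply/funext => i; rewrite fctE.
by rewrite /restr /tail /=; case: ltnP; rewrite ?addr0 ?add0r.
Qed.

(* Otherwise, for every [k], there are [k] successive blocks of norm larger than
   [e] after [k], which together have norm at least [k * e / 2]. *)
Lemma fj_restr_small v (e : R) : fj_bounded N v -> 0 < e ->
  exists K, forall p q, (K <= p)%N -> N (restr p q v) <= e.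
Proof.
move=> vb e0; apply: contrapT => nK.
have next K : {q | (K < q)%N & e < N (restr K q v)}.
  apply: cid2; apply: contrapT => nq; apply: nK; exists K => p q Kp.
  rewrite leNgt; apply/negP => eN; apply: nq.
  have epq : (p < q)%N.
    by rewrite ltnNge; apply/negP => qp; move: eN; rewrite restr_geq // fj0 // ltNge ltW.
  exists q; first exact: leq_ltn_trans epq.
  apply: lt_le_trans eN _; apply: (fj_mono hN) => [|i]; first exact: c00_restr.
  rewrite /restr; case: ifP => [/andP[pi ->]|_]; last by rewrite normr0.
  by rewrite (leq_trans Kp pi).
pose nx K := s2val (next K).
have nxlt K : (K < nx K)%N := s2valP (next K).
have nxe K : e < N (restr K (nx K) v) := s2valP' (next K).
(* [k * e] exceeds [2 * fj_ext N v]; starting the blocks at [k] makes [k] of them admissible. *)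
pose k := (Num.truncn (2 * fj_ext N v / e)).+1.
pose p j := iter j nx k.
have pS j : (p j < p j.+1)%N by exact: nxlt.
have := @fj_ge_sums _ _ hN (restr 0 (p k) v) k p (c00_restr _ _ _) isT (leqnn _)
  (fun j _ => pS j).
apply/negP; rewrite -ltNge.
apply: (@le_lt_trans _ _ (2 * fj_ext N v)); first by rewrite ler_pM2l // le_fj_ext.
apply: (@lt_le_trans _ _ (k%:R * e)).
  by rewrite -ltr_pdivrMr // /k truncnS_gt.
rewrite -[X in X%:R](card_ord k) -sum1_card natr_sum mulr_suml.
apply: ler_sum => j _; rewrite mul1r restr_restr maxn0 (minn_idPl _).
  exact/ltW/nxe.
by apply: (incr_leq (k := k) (fun i _ => pS i)); rewrite ltn_ord leqnn.
Qed.

Lemma fj_ext_tail v (e : R) : fj_bounded N v -> 0 < e ->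
  exists K, forall k, (K <= k)%N -> fj_ext N (tail k v) <= e.
Proof.
move=> vb e0; have [K vK] := fj_restr_small vb e0; exists K => k Kk.
have [//|_ +] := @fj_ext_le e (tail k v) => [q|]; last exact.
rewrite (_ : restr 0 q _ = restr k q v) ?vK //.
by apply/funext => i; rewrite /restr /tail /=; case: (k <= i)%N; case: (i < q)%N.
Qed.

End fj_extension.

(** * Vanishing tails *)

Section fj_tails.
Context {R : realType} {N : (nat -> R) -> R}.
Hypothesis hN : figiel_johnson_norm N.
Implicit Types (x y u v w b : nat -> R) (i j k p q K : nat).

Local Notation M := (fj_ext N).
Local Notation bdd := (fj_bounded N).

Lemma fj_bddD v w : bdd v -> bdd w -> bdd (v + w).
Proof. by move=> vb wb; have [] := fj_extD hN vb wb. Qed.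

Lemma fj_bddZ (t : R) v : bdd v -> bdd (t *: v).
Proof. by move=> vb; have [] := fj_extZ_le hN t vb. Qed.

Lemma fj_ext_le_add v w : bdd v -> bdd w -> M (v + w) <= M v + M w.
Proof. by move=> vb wb; have [] := fj_extD hN vb wb. Qed.

Lemma tail_split k p q v : (k <= p)%N -> (p <= q)%N ->
  tail k v = restr p q v + (restr k p v + tail q v).
Proof.
move=> kp pq; apply/funext => l; rewrite !fctE /tail /restr.
have [lp|pl] := ltnP l p.
  by rewrite andbT [(q <= l)%N]leqNgt (leq_trans lp pq) /= addr0 add0r.
by rewrite (leq_trans kp pl) andbF add0r; case: ltnP; rewrite ?addr0 ?add0r.
Qed.

(** If the norm is almost additive at [x + y], it cannot drop inside the segment: for [t <= s] and
    [p = s x + t y] one has [x + y = p / s + (1 - t / s) y], and the triangle inequality bounds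
    [M p] from below. *)
Lemma fj_ext_segment (c d s t : R) x y : bdd x -> bdd y ->
  c <= M x -> c <= M y -> M x + M y - M (x + y) <= d ->
  0 <= s -> 0 <= t -> s + t = 1 -> c - d <= M (s *: x + t *: y).
Proof.
wlog ts : s t x y / t <= s.
  move=> H xb yb cx cy d0 s0 t0 st.
  have [ts|/ltW st'] := leP t s; first exact: H.
  rewrite [s *: x + _]addrC; apply: H => //; last by rewrite addrC.
  by rewrite [y + x]addrC [M y + _]addrC.
move=> xb yb cx cy xyd s0 t0 st.
have s_gt0 : 0 < s by lra.
set p := s *: x + t *: y.
have pb : bdd p by apply: fj_bddD; exact: fj_bddZ.
have -> : M p = s * M (s^-1 *: p).
  by rewrite fj_extZ // normfV gtr0_norm // mulrA divff ?mul1r // gt_eqF.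
have E : x + y = s^-1 *: p + (1 - t / s) *: y.
  rewrite /p scalerDr !scalerA mulVf ?gt_eqF // scale1r -addrA -scalerDl.
  by rewrite (_ : _ + _ = 1) ?scale1r //; ring.
have t1 : 0 <= 1 - t / s by rewrite subr_ge0 ler_pdivrMr // mul1r.
have := fj_ext_le_add (fj_bddZ s^-1 pb) (fj_bddZ (1 - t / s) yb).
rewrite -E (fj_extZ hN _ yb) ger0_norm // => h.
have d0 : 0 <= d by apply: le_trans xyd; rewrite subr_ge0 fj_ext_le_add.
have : s * (M x + M y - d - (1 - t / s) * M y) <= s * M (s^-1 *: p).
  by rewrite ler_pM2l //; lra.
apply: le_trans.
have -> : s * (M x + M y - d - (1 - t / s) * M y) = s * M x + t * M y - s * d.
  by field; rewrite gt_eqF.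
have : s * c <= s * M x by rewrite ler_pM2l.
have : t * c <= t * M y by rewrite ler_wpM2l.
have : s * d <= 1 * d by rewrite ler_wpM2r //; lra.
have : (s + t) * c = c by rewrite st mul1r.
lra.
Qed.

(** With [r = s + t], the vector [b + s v_m + t v_n] is the convex combination of [b + r v_m] and
    [b + r v_n] with weights [s / r] and [t / r]. The additivity hypothesis is applied to [b / r],
    then rescaled, and [fj_ext_segment] concludes. *)
Lemma fj_ext_step (v : nat -> nat -> R) b (c s t e : R) :
  (forall n, bdd (v n)) ->
  (forall b' (e' : R), c00 b' -> (forall i, 0 <= b' i) -> 0 < e' ->
    exists n0, forall m n, (n0 <= m)%N -> (n0 <= n)%N ->
      M (b' + v m) + M (b' + v n) - M ((b' + v m) + (b' + v n)) <= e') ->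
  c00 b -> (forall i, 0 <= b i) -> 0 <= s -> 0 <= t -> 0 < s + t -> 0 < e ->
  (\forall n \near \oo, c <= M (b + (s + t) *: v n)) ->
  \forall m \near \oo, \forall n \near \oo,
    c - e <= M (b + s *: v m + t *: v n).
Proof.
set r := s + t => vb vadd bc b0 s0 t0 r0 e0 cM.
have rV : 0 < r^-1 by rewrite invr_gt0.
have [i|n0 hn0] := vadd (r^-1 *: b) (e / r) (c00Z _ bc) _ (divr_gt0 e0 r0).
  by rewrite fctE mulr_ge0 // ltW.
have bb : bdd b by have [] := fj_ext_fin hN bc.
have E n : b + r *: v n = r *: (r^-1 *: b + v n).
  by rewrite scalerDr scalerA divff ?scale1r // gt_eqF.
have bv n : bdd (r^-1 *: b + v n) by apply: fj_bddD => //; exact: fj_bddZ.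
have E2 m n : b + s *: v m + t *: v n =
    (s / r) *: (b + r *: v m) + (t / r) *: (b + r *: v n).
  rewrite !scalerDr !scalerA -!mulrA mulVf ?gt_eqF // !mulr1.
  rewrite addrACA -scalerDl -mulrDl divff ?gt_eqF // scale1r.
  by rewrite addrA.
have [n1 _ hn1] := cM.
near=> m; near=> n; rewrite E2.
have mn : (n0 <= m)%N /\ (n1 <= m)%N.
  by split; near: m; exact: nbhs_infty_ge.
have nn : (n0 <= n)%N /\ (n1 <= n)%N.
  by split; near: n; exact: nbhs_infty_ge.
apply: fj_ext_segment.
- by rewrite E; exact: fj_bddZ.
- by rewrite E; exact: fj_bddZ.
- exact: hn1 mn.2.
- exact: hn1 nn.2.
- rewrite !E -scalerDr !fj_extZ //; last exact: fj_bddD.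
  rewrite gtr0_norm // -mulrDr -mulrBr mulrC -ler_pdivlMr //.
  exact: hn0 mn.1 nn.1.
- by rewrite divr_ge0 // ltW.
- by rewrite divr_ge0 // ltW.
- by rewrite -mulrDl divff // gt_eqF.
Unshelve. all: by end_near. Qed.

Lemma fj_restr_cvg0 (a : nat -> nat -> R) (al : nat -> R) K (e : R) :
  (forall i (e' : R), 0 < e' -> \forall n \near \oo, `|a n i - al i| <= e') ->
  0 < e -> \forall n \near \oo, N (restr 0 K (a n - al)) <= e.
Proof.
move=> aal e0.
have : \forall n \near \oo, \sum_(i < K) `|a n i - al i| <= e.
  elim: K e e0 => [|K IH] e e0; first by near=> n; rewrite big_ord0 ltW.
  have e2 : 0 < e / 2 by rewrite divr_gt0.
  near=> n; rewrite big_ord_recr /= [leRHS](splitr e) lerD //.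
    by near: n; exact: IH.
  by near: n; exact: aal.
apply: filterS => n; apply: le_trans; apply: le_trans (fj_le_coords hN _ _) _.
apply: ler_sum => i _; rewrite ler_piMr //; exact: fj_unit_le1.
Unshelve. all: by end_near. Qed.

Section blocks.
Variables (a : nat -> nat -> R) (al : nat -> R).
Hypothesis abdd : forall n, bdd (a n).
Hypothesis a0 : forall n i, 0 <= a n i.
Hypothesis albdd : bdd al.
Hypothesis acvg : forall i (e : R), 0 < e ->
  \forall n \near \oo, `|a n i - al i| <= e.
(** Asymptotic additivity of the norm on the tails, after any fixed finitely supported nonnegative
    shift; the midpoint condition on the test norms will provide it. *)
Hypothesis aadd : forall k b (e : R), c00 b -> (forall i, 0 <= b i) -> 0 < e ->
  exists n0, forall m n, (n0 <= m)%N -> (n0 <= n)%N ->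
    M (b + tail k (a m)) + M (b + tail k (a n))
      - M ((b + tail k (a m)) + (b + tail k (a n))) <= e.

Lemma tail_ge0 k n i : 0 <= tail k (a n) i.
Proof. by rewrite /tail; case: ifP. Qed.

Lemma restr_ge0 p q n i : 0 <= restr p q (a n) i.
Proof. by rewrite /restr; case: ifP. Qed.

Lemma tail_bdd k n : bdd (tail k (a n)).
Proof. exact: fj_bounded_tail. Qed.

(* Blocks [u_1 < u_2 < ...] are cut out of the [a n] one after the other; each
   step replaces a fraction [1/r] of the variable vector [tail k (a n)] by a
   block, at the cost [4 * eta / r]. *)
Lemma fj_blocks k (u0 : nat -> R) (c B eta : R) K0 r :
  c00 u0 -> (forall i, 0 <= u0 i) -> (k <= K0)%N -> (0 < r)%N -> 0 < eta ->
  M (tail k al) <= eta ->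
  (\forall n \near \oo, M (tail k (a n)) <= B) ->
  (\forall n \near \oo, c <= M (u0 + tail k (a n))) ->
  forall i, (i <= r)%N -> exists (K : nat -> nat) (w : nat -> nat -> R),
    [/\ K 0 = K0, (k <= K i)%N,
        forall j, (j < i)%N -> (K j < K j.+1)%N,
        forall j, (j < i)%N -> N (restr (K j) (K j.+1) (w j)) <= B &
        let b := u0 + r%:R^-1 *: \sum_(j < i) restr (K j) (K j.+1) (w j) in
        [/\ c00 b, (forall l, 0 <= b l) & \forall n \near \oo,
        c - i%:R * (4 * eta / r%:R) <= M (b + (1 - i%:R / r%:R) *: tail k (a n))]].
Proof.
move=> u0c u00 kK0 r0 eta0 aleta aB cM.
have rR : 0 < r%:R :> R by rewrite ltr0n.
elim=> [_|i IH ir].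
  exists (fun=> K0), (fun=> 0); split=> //=.
  rewrite big_ord0 scaler0 addr0; split=> //.
  by apply: filterS cM => n; rewrite !mul0r !subr0 scale1r.
have [K [w [K0E kKi KS wB [bc b0 bM]]]] := IH (ltnW ir).
set b := _ + _ in bc b0 bM.
have e0 : 0 < eta / r%:R by rewrite divr_gt0.
have st : 1 - i%:R / r%:R = r%:R^-1 + (1 - i.+1%:R / r%:R) :> R.
  by rewrite -[i.+1%:R]natr1; field; rewrite gt_eqF.
have t0 : 0 <= 1 - i.+1%:R / r%:R :> R.
  by rewrite subr_ge0 ler_pdivrMr // mul1r ler_nat.
rewrite st in bM.
have step := fj_ext_step (tail_bdd k) (aadd k) bc b0 (ltW (_ : 0 < r%:R^-1)) t0 _ e0 bM.
have {}step : \forall m \near \oo, \forall n \near \oo,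
    c - i%:R * (4 * eta / r%:R) - eta / r%:R <=
    M (b + r%:R^-1 *: tail k (a m) + (1 - i.+1%:R / r%:R) *: tail k (a n)).
  by apply: step; rewrite ?invr_gt0 // ltr_pwDl // invr_gt0.
(* One index [m] meets three eventual conditions: its tail obeys the bound [B], it is close to [al]
   before [K i], and the split norm stays large for later [n]. *)
have [m [mB mc mstep]] : exists m, [/\ M (tail k (a m)) <= B,
    N (restr 0 (K i) (a m - al)) <= eta &
    \forall n \near \oo, c - i%:R * (4 * eta / r%:R) - eta / r%:R <=
    M (b + r%:R^-1 *: tail k (a m) + (1 - i.+1%:R / r%:R) *: tail k (a n))].
  have : \forall m \near \oo, [/\ M (tail k (a m)) <= B,
    N (restr 0 (K i) (a m - al)) <= eta &
    \forall n \near \oo, c - i%:R * (4 * eta / r%:R) - eta / r%:R <=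
    M (b + r%:R^-1 *: tail k (a m) + (1 - i.+1%:R / r%:R) *: tail k (a n))].
    have cc := fj_restr_cvg0 (K i) acvg eta0.
    near=> m; split; near: m => //.
  by move=> [m _ /(_ m (leqnn m)) hm]; exists m.
have [K1 hK1] := fj_ext_tail hN (abdd m) eta0.
pose L := maxn K1 (K i).+1.
pose K' j := if (j <= i)%N then K j else L.
pose w' j := if (j < i)%N then w j else a m.
have K'i : K' i.+1 = L by rewrite /K' ltnn.
have KE j : (j <= i)%N -> K' j = K j by rewrite /K' => ->.
have wE j : (j < i)%N -> w' j = w j by rewrite /w' => ->.
have wi : w' i = a m by rewrite /w' ltnn.
have KiL : (K i < L)%N by rewrite /L leq_maxr.
have sE : \sum_(j < i.+1) restr (K' j) (K' j.+1) (w' j) =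
    \sum_(j < i) restr (K j) (K j.+1) (w j) + restr (K i) L (a m).
  rewrite big_ord_recr /= K'i KE // wi; congr (_ + _).
  by apply: eq_bigr => j _; rewrite !KE ?wE // ltnW.
exists K', w'; rewrite K'i sE KE //; split=> //.
- by apply: leq_trans (ltnW KiL).
- move=> j; rewrite ltnS leq_eqVlt => /orP[/eqP->|ji]; first by rewrite K'i KE.
  by rewrite !KE // ?KS // ltnW.
- move=> j; rewrite ltnS leq_eqVlt => /orP[/eqP->|ji].
    rewrite K'i KE // wi; apply: le_trans mB.
    apply: le_trans (le_fj_ext L (tail_bdd k m)).
    apply: (fj_mono hN) => [|l]; first exact: c00_restr.
    rewrite /restr /tail /=; case: ifP => [/andP[Kl ->]|_]; last by rewrite normr0.
    by rewrite (leq_trans kKi Kl).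
  by rewrite !KE ?wE // ?wB // ltnW.
rewrite scalerDr addrA -/b; set u := restr (K i) L (a m).
have uc : c00 (r%:R^-1 *: u) by exact/c00Z/c00_restr.
split=> [|l|]; first exact: c00D.
  by rewrite fctE addr_ge0 // fctE mulr_ge0 ?invr_ge0 ?(ltW rR) ?restr_ge0.
apply: filterS mstep => n.
set t := 1 - _; set y := t *: _.
(* [z] is the part of [tail k (a m)] outside the new block. Its front part is close to that of [al],
   hence at most [2 * eta]; its rear part is at most [eta]. Dropping [z] costs [3 * eta / r],
   besides the [eta / r] lost in the split. *)
pose z := restr k (K i) (a m) + tail L (a m).
have zb : bdd z.
  by apply: fj_bddD; [have [] := fj_ext_fin hN (c00_restr k (K i) (a m))|exact: tail_bdd].
have zE : tail k (a m) = u + z.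
  by rewrite (tail_split _ kKi (ltnW KiL)).
have zeta : M z <= 3 * eta.
  have [rb rE] := fj_ext_fin hN (c00_restr k (K i) (a m)).
  apply: le_trans (fj_ext_le_add rb (tail_bdd L m)) _; rewrite rE.
  have h1 : M (tail L (a m)) <= eta by rewrite hK1 // leq_maxl.
  suff : N (restr k (K i) (a m)) <= 2 * eta by lra.
  have := fjD hN (c00_restr k (K i) al) (c00_restr k (K i) (a m - al)).
  rewrite -restrD [al + _]addrC subrK.
  have h2 : N (restr k (K i) (a m - al)) <= eta.
    apply: le_trans mc; apply: (fj_mono hN) => [|l]; first exact: c00_restr.
    by rewrite /restr /=; case: (k <= l)%N; rewrite //= normr0.
  have h3 : N (restr k (K i) al) <= eta.
    apply: le_trans aleta; apply: le_trans (le_fj_ext (K i) (fj_bounded_tail hN k albdd)).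
    apply: (fj_mono hN) => [|l]; first exact: c00_restr.
    by rewrite /restr /tail /=; case: (k <= l)%N; case: (l < _)%N; rewrite //= normr0.
  lra.
rewrite zE scalerDr addrA [X in M X]addrAC.
have bb : bdd (b + r%:R^-1 *: u + y).
  apply: fj_bddD; last by apply: fj_bddZ; exact: tail_bdd.
  by apply: fj_bddD; [have [] := fj_ext_fin hN bc|have [] := fj_ext_fin hN uc].
have := fj_ext_le_add bb (fj_bddZ r%:R^-1 zb).
rewrite (fj_extZ hN _ zb) // gtr0_norm ?invr_gt0 //.
have : r%:R^-1 * M z <= r%:R^-1 * (3 * eta) by rewrite ler_pM2l // invr_gt0.
rewrite -[i.+1%:R]natr1; lra.
Unshelve. all: by end_near. Qed.

Hypothesis acauchy : forall k (e : R), 0 < e ->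
  exists n0, forall m n, (n0 <= m)%N -> (n0 <= n)%N ->
    `|M (tail k (a m)) - M (tail k (a n))| <= e.

(** Let [L] be the infimum of the eventual bounds of all tails. If [L > 0], far tails have norm
    about [L], and the average built by [fj_blocks] violates [fj_le_average]. *)
Lemma fj_tails_small (e : R) : 0 < e ->
  exists k, \forall n \near \oo, M (tail k (a n)) <= e.
Proof.
move=> e0; apply: contrapT => nk.
pose A := [set l : R | exists k, \forall n \near \oo, M (tail k (a n)) <= l].
have Alb l : A l -> e <= l.
  move=> [k lk]; rewrite leNgt; apply/negP => le; apply: nk; exists k.
  by apply: filterS lk => n nl; rewrite (le_trans nl) // ltW.
have A0 : A !=set0.
  have [n0 hn0] := acauchy 0 ltr01; exists (M (tail 0 (a n0)) + 1), 0%N.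
  near=> n; rewrite -lerBlDl (le_trans (ler_norm _)) // hn0 //.
  by near: n; exact: nbhs_infty_ge.
have hA : has_inf A by split=> //; exists e => l /Alb.
set L := inf A.
have L0 : 0 < L by apply: lt_le_trans e0 _; apply: lb_le_inf => // l /Alb.
(* The construction keeps a norm of at least [2 * L - 10 * eta = 190 * eta], while the upper bound
   will be [101 * (3 / 2 + 1 / 20) * eta], below [157 * eta]. *)
pose eta := L / 100; have eta0 : 0 < eta by rewrite divr_gt0.
have etaE : L = 100 * eta by rewrite /eta; field.
have [l [k1 hk1] lL] := inf_adherent eta0 hA.
have [k2 hk2] := fj_ext_tail hN albdd eta0.
pose k := maxn k1 k2.
have aB : \forall n \near \oo, M (tail k (a n)) <= L + eta.
  apply: filterS hk1 => n h; apply: le_trans (ltW lL); apply: le_trans h.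
  have [] // := fj_ext_mono hN (tail_bdd k1 n) (v := tail k (a n)) _ => i.
  rewrite /tail; case: ifP => ki; last by rewrite normr0.
  by rewrite (leq_trans _ ki) // leq_maxl.
have aL : \forall n \near \oo, L - 2 * eta <= M (tail k (a n)).
  have [n0 hn0] := acauchy k eta0.
  exists n0 => // n /= n0n; rewrite leNgt; apply/negP => h.
  (* Otherwise the Cauchy property would make [L - eta], which is below the infimum, an eventual
     bound. *)
  suff /(ge_inf hA.2) : A (L - eta) by rewrite -/L; lra.
  exists k; exists n0 => // n' /= n0n'.
  have := hn0 n' n n0n' n0n; rewrite ler_norml => /andP[_]; lra.
have al2 : M (tail k al) <= eta by rewrite hk2 // leq_maxr.
have c00_0 : c00 (0 : nat -> R) by apply/c00P; exists 0%N.
(* The head comes from splitting twice the tail into two tails of weight 1, with [b = 0]. *)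
have step0 : \forall m \near \oo, \forall n \near \oo,
    2 * (L - 2 * eta) - eta <= M (0 + 1 *: tail k (a m) + 1 *: tail k (a n)).
  apply: (fj_ext_step (tail_bdd k) (aadd k)) => //.
  apply: filterS aL => n h; rewrite add0r fj_extZ //; last exact: tail_bdd.
  by rewrite ger0_norm // ler_pM2l.
have [m0 mB m0step] : exists2 m, M (tail k (a m)) <= L + eta &
    \forall n \near \oo, 2 * (L - 2 * eta) - eta <=
      M (0 + 1 *: tail k (a m) + 1 *: tail k (a n)).
  have : \forall m \near \oo, M (tail k (a m)) <= L + eta /\
    \forall n \near \oo, 2 * (L - 2 * eta) - eta <=
      M (0 + 1 *: tail k (a m) + 1 *: tail k (a n)).
    by near=> m; split; near: m.
  by move=> [m _ /(_ m (leqnn m)) []]; exists m.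
have [K1 hK1] := fj_ext_tail hN (abdd m0) eta0.
pose K0 := maxn k K1.
pose u0 := restr 0 K0 (tail k (a m0)).
have u0c : c00 u0 by exact: c00_restr.
have [u0b u0E] := fj_ext_fin hN u0c.
have u00 i : 0 <= u0 i.
  by rewrite /u0 /restr; case: ifP => // _; exact: tail_ge0.
have u0B : N u0 <= L + eta.
  by apply: le_trans mB; apply: le_fj_ext; exact: tail_bdd.
have cM : \forall n \near \oo, 2 * L - 6 * eta <= M (u0 + tail k (a n)).
  apply: filterS m0step => n; rewrite !scale1r add0r.
  have -> : tail k (a m0) = u0 + tail K0 (a m0).
    apply/funext => i; rewrite fctE /u0 /restr /tail /=.
    have [ki|ik] := leqP k i; have [iK|Ki] := ltnP i K0; rewrite ?addr0 ?add0r //.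
    by have := leq_trans ik (leq_trans (leq_maxl k K1) Ki); rewrite ltnn.
  rewrite addrAC => h.
  have := fj_ext_le_add (fj_bddD u0b (tail_bdd k n)) (tail_bdd K0 m0).
  have : M (tail K0 (a m0)) <= eta by rewrite hK1 // leq_maxr.
  lra.
(* With [r > 10 * K0] the term [K0 / (2 * r)] of [fj_le_average] is at most 1/20. *)
pose r := (10 * K0).+1.
have [K [w [KE _ KS wB [bc _]]]] := fj_blocks u0c u00 (leq_maxl k K1) (ltn0Sn (10 * K0))
  eta0 al2 aB cM (leqnn r).
rewrite -/r; set b := _ + _ in bc *.
have rR : 0 < r%:R :> R by rewrite ltr0n.
have -> : r%:R * (4 * eta / r%:R) = 4 * eta by field; rewrite gt_eqF.
rewrite divff ?gt_eqF // subrr => -[n _ /(_ n (leqnn n))].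
rewrite scale0r addr0 (fj_ext_fin hN bc).2; apply/negP; rewrite -ltNge.
apply: (@le_lt_trans _ _ ((L + eta) * (3 / 2 + K0%:R / (2 * r%:R)))).
  rewrite -/K0 in KE.
  have := @fj_le_average _ _ hN (L + eta) r K (tail k (a m0)) w isT KS.
  by rewrite KE; apply.
have h : K0%:R / (2 * r%:R) <= 1 / 20 :> R.
  rewrite ler_pdivrMr ?mulr_gt0 //.
  have -> : r%:R = 10 * K0%:R + 1 :> R by rewrite -[r%:R]natr1 natrM.
  lra.
apply: (@le_lt_trans _ _ ((L + eta) * (3 / 2 + 1 / 20))); last by rewrite etaE; lra.
by rewrite ler_wpM2l ?lerD2l //; lra.
Unshelve. all: by end_near. Qed.

End blocks.
End fj_tails.

(** * Null sequences and symmetric lattice norms *)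

Section null_sequences.
Context {R : realType}.
Implicit Types (x y z : nat -> R) (s : seq nat).

Lemma c0P x : c0 x <->
  forall e : R, 0 < e -> exists K, forall i, (K <= i)%N -> `|x i| <= e.
Proof.
split=> [/cvgr0Pnorm_le xc e e0|xc].
  by have [K _ hK] := xc e e0; exists K.
by apply/cvgr0Pnorm_le => e e0; have [K hK] := xc e e0; exists K.
Qed.

Lemma c0D x y : c0 x -> c0 y -> c0 (x + y).
Proof.
move=> /c0P xc /c0P yc; apply/c0P => e e0.
have e2 : 0 < e / 2 by rewrite divr_gt0.
have [K hK] := xc _ e2; have [L hL] := yc _ e2.
exists (maxn K L) => i; rewrite geq_max => /andP[/hK hx /hL hy].
by rewrite (le_trans (ler_normD _ _)) // [leRHS]splitr lerD.
Qed.

Lemma c0_dom (c : R) x y : c0 y -> (forall i, `|x i| <= c * `|y i|) -> c0 x.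
Proof.
move=> /c0P yc xy; apply/c0P => e e0.
have c1 : 0 < `|c| + 1 by rewrite ltr_wpDl.
have [K hK] := yc _ (divr_gt0 e0 c1); exists K => i /hK yi.
apply: le_trans (xy i) _.
apply: (@le_trans _ _ ((`|c| + 1) * `|y i|)).
  by rewrite ler_wpM2r // (le_trans (ler_norm c)) // lerDl.
by rewrite mulrC -ler_pdivlMr.
Qed.

Lemma c0Z (a : R) x : c0 x -> c0 (a *: x).
Proof. by move=> xc; apply: (@c0_dom `|a| _ x) => // i; rewrite normrM. Qed.

Lemma c0_zero : c0 (0 : nat -> R).
Proof. by apply/c0P => e e0; exists 0%N => i _; rewrite normr0 ltW. Qed.

Lemma c0_perm (sigma : nat -> nat) x : bijective sigma -> c0 x -> c0 (x \o sigma).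
Proof.
move=> [tau st ts] /c0P xc; apply/c0P => e e0; have [K hK] := xc e e0.
exists (\max_(i < K) (tau i).+1)%N => i iM; rewrite /= hK // leqNgt.
apply/negP => siK; move: iM; apply/negP; rewrite -ltnNge.
apply: leq_trans (leq_bigmax (Ordinal siK)).
by rewrite /= st.
Qed.

Lemma c0_unit i : c0 (unit_vec R i).
Proof.
apply/c0P => e e0; exists i.+1 => j ij.
by rewrite /unit_vec gtn_eqF // normr0 ltW.
Qed.

Lemma c0_bounded x : c0 x -> has_ubound (range (fun i => `|x i|)).
Proof.
move=> /c0P /(_ 1 ltr01)[K xK].
exists (\sum_(i < K) `|x i| + 1) => _ [i _ <-].
have [iK|/xK h] := ltnP i K; last by rewrite (le_trans h) // lerDr sumr_ge0.
by rewrite (bigD1 (Ordinal iK)) //= -addrA lerDl addr_ge0 // sumr_ge0.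
Qed.

Lemma le_sup_norm x i : c0 x -> `|x i| <= sup_norm x.
Proof. by move=> xc; apply: ub_le_sup; [exact: c0_bounded|exists i]. Qed.

Lemma sup_norm_le (B : R) x : (forall i, `|x i| <= B) -> sup_norm x <= B.
Proof. by move=> xB; apply: ge_sup => [|_ [i _ <-]//]; exists `|x 0|, 0%N. Qed.

Lemma sup_norm_ge0 x : c0 x -> 0 <= sup_norm x.
Proof. by move=> xc; apply: le_trans (le_sup_norm 0 xc). Qed.

Lemma fresh_nat s : exists i, i \notin s.
Proof.
exists (\max_(i <- s) i).+1; apply/negP => h.
by have := @leq_bigmax_seq _ s predT id _ h erefl; rewrite ltnn.
Qed.

(** If some coordinate outside [s] is nonzero, all but finitely many are at most as large, so the
    maximum is over a finite set; otherwise any fresh index will do. *)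
Lemma c0_max_out x s : c0 x ->
  exists2 i : nat, i \notin s & forall j : nat, j \notin s -> `|x j| <= `|x i|.
Proof.
move=> /c0P xc; have [i0 i0s] := fresh_nat s.
have [[j0 j0s xj0]|nz] := pselect (exists2 j, j \notin s & x j != 0); last first.
  exists i0 => // j js; suff -> : x j = 0 by rewrite normr0.
  by apply/eqP/negPn/negP => xj; apply: nz; exists j.
have [K hK] := xc `|x j0| (eqbRL (normr_gt0 _) xj0).
have j0K : (j0 < K + j0.+1)%N by rewrite addnS ltnS leq_addl.
have [i1 i1s hi1] : exists2 i1 : 'I_(K + j0.+1), val i1 \notin s &
    forall j : 'I_(K + j0.+1), val j \notin s -> `|x j| <= `|x i1|.
  by case: (@arg_maxP _ _ _ (Ordinal j0K) (fun i => val i \notin s)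
    (fun i : 'I__ => `|x i|) j0s) => i1; exists i1.
exists (val i1) => // j js; have [jK|Kj] := ltnP j (K + j0.+1).
  exact: (hi1 (Ordinal jK)).
apply: le_trans (hi1 (Ordinal j0K) j0s); apply: hK.
exact: leq_trans (leq_addr _ _) Kj.
Qed.

(** Picking maximal coordinates one after the other lists the indices of the [n] largest absolute
    values in nonincreasing order. *)
Lemma c0_greedy x n : c0 x -> exists s, [/\ uniq s, size s = n &
  forall k, (k < n)%N -> forall j, j \notin take k s ->
    `|x j| <= `|x (nth 0%N s k)|].
Proof.
move=> xc; elim: n => [|n [s [us sn gs]]]; first by exists [::].
have [i is_ hi] := c0_max_out s xc.
exists (rcons s i); split; first by rewrite rcons_uniq is_.
  by rewrite size_rcons sn.
move=> k; rewrite ltnS => kn j; rewrite nth_rcons -cats1 takel_cat ?sn //.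
move: kn; rewrite leq_eqVlt => /orP[/eqP->|kn].
  by rewrite ltnn eqxx -sn take_size; exact: hi.
by rewrite kn; exact: gs.
Qed.

End null_sequences.

(** * Cardinality bounds from lists of indices *)

Lemma card_uniq_seq (s : seq nat) : uniq s -> ([set` s] #= `I_(size s))%card.
Proof.
move=> us; have -> : [set` s] = nth 0%N s @` `I_(size s).
  apply/seteqP; split=> [i /= /(nthP 0%N)[k ks <-]|_ [k /= ks <-]]; first by exists k.
  exact: mem_nth.
apply: inj_card_eq => k l /set_mem /= ks /set_mem /= ls /eqP.
by rewrite nth_uniq // => /eqP.
Qed.

Lemma size_le_card (A : set nat) (s : seq nat) n : uniq s ->
  (forall i, i \in s -> A i) -> (A #<= `I_n)%card -> (size s <= n)%N.
Proof.
move=> us sA An; rewrite -card_le_II; apply: card_le_trans An.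
by rewrite -(card_le_eql (card_uniq_seq us)); exact: subset_card_le.
Qed.

Lemma card_le_size (A : set nat) (s : seq nat) n : (size s <= n)%N ->
  (forall i, A i -> i \in s) -> (A #<= `I_n)%card.
Proof.
move=> sn As; apply: (@card_le_trans _ _ _ [set` undup s]).
  by apply: subset_card_le => i /As /=; rewrite mem_undup.
rewrite (card_le_eql (card_uniq_seq (undup_uniq s))) card_le_II.
exact: leq_trans (size_undup s) sn.
Qed.

(** * Nonincreasing rearrangements *)

Section rearrangement.
Context {R : realType}.
Implicit Types (x y z : nat -> R) (s : seq nat).

Lemma decr_rearr_le x n (t : R) : 0 <= t ->
  ([set i | t < `|x i|] #<= `I_n)%card -> decr_rearr x n <= t.
Proof. by move=> t0 xt; apply: ge_inf => //; exists 0 => r []. Qed.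

Lemma decr_rearr_ge x n s (t : R) : c0 x -> uniq s -> (n < size s)%N ->
  (forall i, i \in s -> t <= `|x i|) -> t <= decr_rearr x n.
Proof.
move=> xc us ns st; apply: lb_le_inf.
  exists (sup_norm x); split; first exact: sup_norm_ge0.
  rewrite (_ : [set _ | _] = set0) ?card_ge0 //.
  by apply/seteqP; split=> i //=; rewrite ltNge le_sup_norm.
move=> r [r0 rx]; rewrite leNgt; apply/negP => rt.
suff : (size s <= n)%N by rewrite leqNgt ns.
by apply: (size_le_card us _ rx) => i /st /= ti; exact: lt_le_trans rt ti.
Qed.

(** Only the [k] indices listed before position [k] can carry values above the one at [k], while the
    first [k + 1] listed all reach it. *)
Lemma decr_rearr_greedy x n s : c0 x -> uniq s -> size s = n ->
  (forall k, (k < n)%N -> forall j, j \notin take k s ->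
    `|x j| <= `|x (nth 0%N s k)|) ->
  forall k, (k < n)%N -> decr_rearr x k = `|x (nth 0%N s k)|.
Proof.
move=> xc us sn gs k kn; apply/le_anti/andP; split.
  apply: decr_rearr_le => //; apply: (@card_le_size _ (take k s)).
    by rewrite size_take sn kn.
  move=> i /=; apply: contraTT => /(gs _ kn); rewrite -leNgt; exact.
apply: (@decr_rearr_ge _ _ (take k.+1 s)) => //.
- by rewrite take_uniq.
- by rewrite size_takel ?sn.
move=> i /(nthP 0%N)[j]; rewrite size_takel ?sn // ltnS => jk <-.
rewrite nth_take //; apply: gs; first exact: leq_ltn_trans jk kn.
apply/negP => /(nthP 0%N)[l]; rewrite size_takel ?sn; last first.
  exact: leq_trans jk (ltnW kn).
move=> lj; rewrite nth_take // => /eqP; rewrite nth_uniq ?sn //.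
- by rewrite ltn_eqF // (leq_trans lj).
- by rewrite (leq_trans (leq_trans lj jk)) // ltnW.
Qed.

Lemma decr_rearr_attained x n : c0 x -> exists s, [/\ uniq s, size s = n,
  (forall k, (k < n)%N -> decr_rearr x k = `|x (nth 0%N s k)|) &
  (forall k, (k < n)%N -> forall j, j \notin take k s ->
    `|x j| <= `|x (nth 0%N s k)|)].
Proof.
move=> xc; have [s [us sn gs]] := c0_greedy n xc; exists s; split=> //.
exact: decr_rearr_greedy.
Qed.

Lemma decr_rearr_ge0 x n : c0 x -> 0 <= decr_rearr x n.
Proof.
by move=> xc; have [s [_ _ -> //]] := decr_rearr_attained n.+1 xc; exact: ltnSn.
Qed.

Lemma decr_rearr_dom (c : R) x y n : 0 <= c -> c0 y ->
  (forall i, `|x i| <= c * `|y i|) -> decr_rearr x n <= c * decr_rearr y n.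
Proof.
move=> c_ge0 yc xy; have [s [us sn -> // gs]] := decr_rearr_attained n.+1 yc.
apply: decr_rearr_le; first by rewrite mulr_ge0.
apply: (@card_le_size _ (take n s)); first by rewrite size_takel // sn.
move=> i /=; apply: contraTT => /(gs n (ltnSn n)) h; rewrite -leNgt.
by apply: le_trans (xy i) _; rewrite ler_wpM2l.
Qed.

Lemma decr_rearr_perm (sigma : nat -> nat) x n : bijective sigma -> c0 x ->
  decr_rearr (x \o sigma) n <= decr_rearr x n.
Proof.
move=> [tau st ts] xc; have [s [us sn -> // gs]] := decr_rearr_attained n.+1 xc.
apply: decr_rearr_le => //; apply: (@card_le_size _ (map tau (take n s))).
  by rewrite size_map size_takel // sn.
move=> i /=; apply: contraTT => h; rewrite -leNgt.
by apply: gs => //; apply: contra h => h; rewrite -(st i) map_f.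
Qed.

(** Induction removing the index of a smallest coordinate: all [size s] coordinates are at least
    that large, so it is bounded by the last term on the right. *)
Lemma sum_le_decr_rearr x s : c0 x -> uniq s ->
  \sum_(i <- s) `|x i| <= \sum_(k < size s) decr_rearr x k.
Proof.
move=> xc; have [n sn] := ubnP (size s); elim: n s sn => // n IH s sn us.
have [->|s0] := eqVneq s [::]; first by rewrite big_nil big_ord0.
have [i0 i0s hi] : exists2 i0, i0 \in s & forall j, j \in s -> `|x i0| <= `|x j|.
  elim: s s0 {sn us IH} => // a [|b s] IH _; first by exists a; rewrite ?mem_head // => j; rewrite inE => /eqP ->.
  have [//|i0 i0s hi] := IH.
  have [ai|/ltW ia] := leP `|x a| `|x i0|.
    exists a; first exact: mem_head.
    move=> j; rewrite inE => /orP[/eqP->//|/hi]; exact: le_trans.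
  exists i0; first by rewrite inE i0s orbT.
  by move=> j; rewrite inE => /orP[/eqP->//|/hi].
have sz : size s = (size (rem i0 s)).+1.
  by rewrite size_rem // prednK // lt0n size_eq0.
rewrite (perm_big _ (perm_to_rem i0s)) big_cons sz big_ord_recr /= addrC lerD //.
  by apply: IH; rewrite ?rem_uniq // -ltnS -sz.
by apply: (@decr_rearr_ge _ _ s) => //; rewrite sz.
Qed.

(** Ky Fan's inequality: on the indices of the [n] largest coordinates of [x + y], the sums for [x]
    and for [y] are at most those of their rearrangements. *)
Lemma sum_decr_rearrD x y n : c0 x -> c0 y ->
  \sum_(k < n) decr_rearr (x + y) k <=
  \sum_(k < n) (decr_rearr x k + decr_rearr y k).
Proof.
move=> xc yc; have [s [us sn ds _]] := decr_rearr_attained n (c0D xc yc).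
rewrite big_split /=.
have := lerD (sum_le_decr_rearr xc us) (sum_le_decr_rearr yc us).
rewrite sn; apply: le_trans.
rewrite -big_split /= (big_nth 0%N) big_mkord sn.
by apply: ler_sum => k _; rewrite ds // fctE ler_normD.
Qed.

(** Summation by parts for nonincreasing weights; the induction shows the stronger fact that the
    weighted sum is at least its last weight times the full sum of [d]. *)
Lemma abel_sum_ge0 (w d : nat -> R) n : (forall k, w k.+1 <= w k) ->
  (forall k, 0 <= w k) -> (forall k, (k <= n)%N -> 0 <= \sum_(j < k) d j) ->
  0 <= \sum_(k < n) w k * d k.
Proof.
move=> wd w0; elim: n d => [|n IH] d dn; first by rewrite big_ord0.
suff : w n * \sum_(j < n.+1) d j <= \sum_(k < n.+1) w k * d k.
  by apply: le_trans; rewrite mulr_ge0 // dn.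
elim: n dn {IH} => [|n IH] dn; first by rewrite !big_ord_recr !big_ord0 /= !add0r.
rewrite big_ord_recr [leRHS]big_ord_recr /= mulrDr lerD2r.
apply: le_trans (IH _) => [|k kn]; last by rewrite dn // (leq_trans kn).
by rewrite ler_wpM2r // dn // ltnW.
Qed.

Lemma nneg_series_le (u : nat -> R) (B : R) : (forall i, 0 <= u i) ->
  (forall n, \sum_(k < n) u k <= B) -> cvgn (series u) /\ limn (series u) <= B.
Proof.
move=> u0 uB; have cu : cvgn (series u).
  apply: nondecreasing_is_cvgn; first exact: nondecreasing_series.
  by exists B => _ [n _ <-]; rewrite /series /= big_mkord.
by split=> //; apply: limr_le => //; near=> n; rewrite /series /= big_mkord.
Unshelve. all: by end_near. Qed.

Lemma nneg_series_ge (u : nat -> R) n : (forall i, 0 <= u i) ->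
  cvgn (series u) -> \sum_(k < n) u k <= limn (series u).
Proof.
move=> u0 cu; have := nondecreasing_cvgn_le (nondecreasing_series (fun k _ _ => u0 k)) cu n.
by rewrite /series /= big_mkord.
Qed.

Lemma harmonic_unbounded (B : R) : exists n, B < \sum_(k < n) (k.+1%:R)^-1.
Proof.
apply: contrapT => nB; apply: (@dvg_harmonic R).
have [] // := @nneg_series_le (@harmonic R) B (fun i => harmonic_ge0 i) => n.
by rewrite leNgt; apply/negP => h; apply: nB; exists n.
Qed.

End rearrangement.

(** The common interface of the two spaces [F]. [sln_dom] combines solidity, invariance under signs
    and an upper bound for multiples. *)
Record symmetric_lattice_norm (R : realType) (F : set (nat -> R))
    (pF : (nat -> R) -> R) : Prop := SymmetricLatticeNorm {
  sln_unit : forall i, F (unit_vec R i);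
  sln_add : forall y z, F y -> F z -> F (y + z) /\ pF (y + z) <= pF y + pF z;
  sln_dom : forall (c : R) y z, 0 <= c -> F z ->
    (forall i, `|y i| <= c * `|z i|) -> F y /\ pF y <= c * pF z;
  sln_perm : forall (sigma : nat -> nat) z, bijective sigma -> F z ->
    F (z \o sigma) /\ pF (z \o sigma) <= pF z;
  sln_coord : forall z i, F z -> `|z i| <= pF z;
  (* the condition that ||e_1 + ... + e_n||_F tends to infinity, quantified
     over all vectors dominating such a sum *)
  sln_count : forall B : R, exists n, forall z (s : seq nat), F z -> uniq s ->
    (n <= size s)%N -> (forall i, i \in s -> 1 <= `|z i|) -> B < pF z }.

(** * The spaces l_1 and d_{w,1} *)

Section instances.
Context {R : realType}.
Implicit Types (x y z : nat -> R) (s : seq nat).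

Lemma ell1P z (B : R) : (forall n, \sum_(k < n) `|z k| <= B) ->
  ell1 z /\ ell1_norm z <= B.
Proof. by move=> h; apply: nneg_series_le. Qed.

Lemma ell1_ge z n : ell1 z -> \sum_(k < n) `|z k| <= ell1_norm z.
Proof. exact: nneg_series_ge. Qed.

Lemma ell1_ge_seq z s : ell1 z -> uniq s -> \sum_(i <- s) `|z i| <= ell1_norm z.
Proof.
move=> zF us; apply: le_trans (ell1_ge (\max_(i <- s) i.+1) zF).
rewrite -(big_mkord xpredT (fun i => `|z i|)).
apply: (@le_trans _ _ (\sum_(i <- [seq i <- index_iota 0 (\max_(i <- s) i.+1) | i \in s]) `|z i|)).
  rewrite le_eqVlt; apply/orP; left; apply/eqP; apply: perm_big.
  apply: uniq_perm => //; first by rewrite filter_uniq // iota_uniq.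
  move=> i; rewrite mem_filter mem_index_iota /=.
  case: (boolP (i \in s)) => //= ins; symmetry.
  exact: (@leq_bigmax_seq _ s predT S i ins erefl).
by rewrite big_filter [leRHS](bigID (mem s)) /= lerDl sumr_ge0.
Qed.

Lemma ell1_symmetric : symmetric_lattice_norm (@ell1 R) (@ell1_norm R).
Proof.
split.
- move=> i; have [] // := @ell1P (unit_vec R i) 1 => n.
  have [ni|iN] := leqP n i.
    rewrite big1 // => k _; rewrite /unit_vec ltn_eqF ?normr0 //.
    exact: leq_trans (ltn_ord k) ni.
  rewrite (bigD1 (Ordinal iN)) //= /unit_vec eqxx normr1 big1 ?addr0 // => k.
  by rewrite -val_eqE /= => /negPf ->; rewrite normr0.
- move=> y z yF zF; apply: ell1P => n.
  apply: le_trans (lerD (ell1_ge n yF) (ell1_ge n zF)).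
  by rewrite -big_split; apply: ler_sum => k _; rewrite fctE ler_normD.
- move=> c y z c_ge0 zF yz; apply: ell1P => n.
  apply: le_trans (ler_wpM2l c_ge0 (ell1_ge n zF)).
  by rewrite mulr_sumr; apply: ler_sum.
- move=> sigma z sb zF; apply: ell1P => n.
  have us : uniq (map sigma (index_iota 0 n)) by rewrite map_inj_uniq ?iota_uniq //; exact: bij_inj.
  apply: le_trans (ell1_ge_seq zF us).
  by rewrite big_map big_mkord.
- move=> z i zF; apply: le_trans (ell1_ge_seq (s := [:: i]) zF isT).
  by rewrite big_seq1.
move=> B; exists (Num.truncn B).+1 => z s zF us ns zs.
apply: lt_le_trans (ell1_ge_seq zF us).
apply: (@lt_le_trans _ _ (size s)%:R).
  by apply: lt_le_trans (truncnS_gt B) _; rewrite ler_nat.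
rewrite -sum1_size natr_sum big_seq [leRHS]big_seq.
exact: ler_sum.
Qed.

Lemma lorentzP z (B : R) : c0 z ->
  (forall n, \sum_(k < n) decr_rearr z k / k.+1%:R <= B) ->
  lorentz z /\ lorentz_norm z <= B.
Proof.
move=> zc zB; have [] := @nneg_series_le _ (fun k => decr_rearr z k / k.+1%:R) B => //.
by move=> i; rewrite divr_ge0 // decr_rearr_ge0.
Qed.

Lemma lorentz_ge z n : lorentz z ->
  \sum_(k < n) decr_rearr z k / k.+1%:R <= lorentz_norm z.
Proof.
move=> [zc zF]; apply: (@nneg_series_ge _ (fun k => decr_rearr z k / k.+1%:R)) => // i.
by rewrite divr_ge0 // decr_rearr_ge0.
Qed.

Lemma lorentz_symmetric : symmetric_lattice_norm (@lorentz R) (@lorentz_norm R).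
Proof.
split.
- move=> i; have [] // := @lorentzP (unit_vec R i) 1 (c0_unit i) => n.
  have d0 k : decr_rearr (unit_vec R i) k.+1 = 0.
    apply/le_anti; rewrite decr_rearr_ge0 ?andbT; last exact: c0_unit.
    apply: decr_rearr_le => //; apply: (@card_le_size _ [:: i]) => // j /=.
    by rewrite /unit_vec inE; case: eqP => // _; rewrite normr0 ltxx.
  case: n => [|n]; first by rewrite big_ord0.
  rewrite big_ord_recl /= big1 ?addr0 ?divr1 => [|k _].
    apply: decr_rearr_le => //; apply: (@card_le_size _ [::]) => // j /=.
    by rewrite /unit_vec; case: eqP => _; rewrite ?normr1 ?normr0 ltNge ?lexx ?ler01.
  by rewrite d0 mul0r.
- move=> y z yF zF; have yc := yF.1; have zc := zF.1.
  apply: lorentzP => [|n]; first exact: c0D.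
  apply: le_trans (lerD (lorentz_ge n yF) (lorentz_ge n zF)).
  rewrite -big_split -subr_ge0 -sumrB.
  rewrite (eq_bigr (fun k : 'I_n => (k.+1%:R)^-1 *
    (decr_rearr y k + decr_rearr z k - decr_rearr (y + z) k))); last first.
    by move=> k _; rewrite /= -mulrDl -mulrBl mulrC.
  (* Partial sums of rearrangements are subadditive; Abel summation carries this over to the
     nonincreasing weights [1 / (k + 1)]. *)
  apply: (@abel_sum_ge0 _ (fun k => (k.+1%:R)^-1)
    (fun k => decr_rearr y k + decr_rearr z k - decr_rearr (y + z) k)).
  + by move=> k; rewrite lef_pV2 ?posrE ?ltr0n // ler_nat.
  + by move=> k; rewrite invr_ge0.
  by move=> k _; rewrite sumrB subr_ge0 sum_decr_rearrD.
- move=> c y z c_ge0 zF yz; have zc := zF.1.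
  apply: lorentzP => [|n]; first exact: (c0_dom (c := c) zc).
  apply: le_trans (ler_wpM2l c_ge0 (lorentz_ge n zF)).
  rewrite mulr_sumr; apply: ler_sum => k _; rewrite mulrA.
  by rewrite ler_wpM2r ?invr_ge0 // decr_rearr_dom.
- move=> sigma z sb zF; have zc := zF.1.
  apply: lorentzP => [|n]; first exact: c0_perm.
  apply: le_trans (lorentz_ge n zF); apply: ler_sum => k _.
  by rewrite ler_wpM2r ?invr_ge0 // decr_rearr_perm.
- move=> z i zF; apply: le_trans (lorentz_ge 1 zF).
  rewrite big_ord1 divr1; apply: (@decr_rearr_ge _ _ _ [:: i]) => //.
    exact: zF.1.
  by move=> j; rewrite inE => /eqP ->.
(* Having [n] coordinates of modulus at least 1 forces the norm up to the [n]-th harmonic sum. *)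
move=> B; have [n hn] := harmonic_unbounded B; exists n => z s zF us ns zs.
apply: lt_le_trans hn _; apply: le_trans (lorentz_ge n zF).
apply: ler_sum => k _; rewrite ler_peMl ?invr_ge0 //.
apply: (@decr_rearr_ge _ _ _ s) => //; first exact: zF.1.
exact: leq_trans (ltn_ord k) ns.
Qed.

End instances.

(** * The interpolation norms *)

Lemma minkowski2 (R : rcfType) (a b c d : R) :
  Num.sqrt ((a + b) ^+ 2 + (c + d) ^+ 2) <=
  Num.sqrt (a ^+ 2 + c ^+ 2) + Num.sqrt (b ^+ 2 + d ^+ 2).
Proof.
set p := a ^+ 2 + c ^+ 2; set q := b ^+ 2 + d ^+ 2.
have p0 : 0 <= p by rewrite addr_ge0 ?sqr_ge0.
have q0 : 0 <= q by rewrite addr_ge0 ?sqr_ge0.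
have h0 : 0 <= (a + b) ^+ 2 + (c + d) ^+ 2 by rewrite addr_ge0 ?sqr_ge0.
rewrite -(ler_pXn2r (n := 2)) ?nnegrE ?addr_ge0 ?sqrtr_ge0 //.
rewrite [leRHS]sqrrD !sqr_sqrtr //.
suff : a * b + c * d <= Num.sqrt p * Num.sqrt q by rewrite /p /q; lra.
rewrite -sqrtrM // (le_trans (ler_norm _)) // -sqrtr_sqr ler_wsqrtr //.
(* Cauchy-Schwarz in the plane, through Lagrange's identity. *)
have := sqr_ge0 (a * d - b * c); rewrite /p /q; lra.
Qed.

Lemma minkowski (R : rcfType) (I : Type) (s : seq I) (f g : I -> R) :
  Num.sqrt (\sum_(i <- s) (f i + g i) ^+ 2) <=
  Num.sqrt (\sum_(i <- s) f i ^+ 2) + Num.sqrt (\sum_(i <- s) g i ^+ 2).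
Proof.
elim: s => [|i s IH]; first by rewrite !big_nil sqrtr0 addr0.
rewrite !big_cons.
set A := \sum_(j <- s) _ in IH *; set B := \sum_(j <- s) _ in IH *.
set C := \sum_(j <- s) _ in IH *.
have A0 : 0 <= A by apply: sumr_ge0 => j _; exact: sqr_ge0.
have B0 : 0 <= B by apply: sumr_ge0 => j _; exact: sqr_ge0.
have C0 : 0 <= C by apply: sumr_ge0 => j _; exact: sqr_ge0.
have := minkowski2 (f i) (g i) (Num.sqrt B) (Num.sqrt C).
rewrite !sqr_sqrtr //; apply: le_trans; apply: ler_wsqrtr; rewrite lerD2l.
by rewrite -[leLHS]sqr_sqrtr // lerXn2r ?nnegrE ?addr_ge0 ?sqrtr_ge0.
Qed.

Section interpolation.
Context {R : realType} {F : set (nat -> R)} {pF : (nat -> R) -> R}.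
Hypothesis hF : symmetric_lattice_norm F pF.
Implicit Types (x y z : nat -> R) (s : seq nat) (m : nat).

Local Notation I := (interp_norm F pF).

Lemma sln0 : F 0 /\ pF 0 = 0.
Proof.
have [F0 p0] : F 0 /\ pF 0 <= 0 * pF (unit_vec R 0).
  by apply: (sln_dom hF) => //; [exact: (sln_unit hF)|move=> i; rewrite mul0r normr0].
split=> //; apply/le_anti; rewrite (le_trans p0) ?mul0r //=.
by apply: le_trans (sln_coord hF 0 F0).
Qed.

Lemma sln_ge0 z : F z -> 0 <= pF z.
Proof. by move=> Fz; apply: le_trans (sln_coord hF 0 Fz). Qed.

Lemma interp_lbound m x : has_lbound [set r : R | exists y z : nat -> R,
        [/\ c0 y, F z, x = m%:R^-1 *: y + m%:R *: z &
            r = Num.sqrt (sup_norm y ^+ 2 + pF z ^+ 2)]].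
Proof. by exists 0 => _ [y [z [_ _ _ ->]]]; exact: sqrtr_ge0. Qed.

Lemma interp_le m x y z : c0 y -> F z -> x = m%:R^-1 *: y + m%:R *: z ->
  I m x <= Num.sqrt (sup_norm y ^+ 2 + pF z ^+ 2).
Proof. by move=> yc zF ->; apply: ge_inf; [exact: interp_lbound|exists y, z]. Qed.

Lemma interp_approx m x (e : R) : (0 < m)%N -> c0 x -> 0 < e ->
  exists y z, [/\ c0 y, F z, x = m%:R^-1 *: y + m%:R *: z &
    Num.sqrt (sup_norm y ^+ 2 + pF z ^+ 2) < I m x + e].
Proof.
move=> m0 xc e0.
have [|r [y [z [yc zF xE ->]]] rI] := inf_adherent e0 (E := [set r : R | exists y z,
    [/\ c0 y, F z, x = m%:R^-1 *: y + m%:R *: z &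
            r = Num.sqrt (sup_norm y ^+ 2 + pF z ^+ 2)]]).
  split; last exact: interp_lbound.
  (* The decomposition [y = m x], [z = 0] shows that the infimum is over a nonempty set. *)
  eexists; exists (m%:R *: x), 0; split; first exact: c0Z.
  - exact: sln0.1.
  - by rewrite scaler0 addr0 scalerA mulVf ?scale1r // pnatr_eq0 -lt0n.
  by [].
by exists y, z.
Qed.

Lemma interp_ge0 m x : 0 <= I m x.
Proof.
rewrite /interp_norm; set A := [set _ | _].
have [A0|/set0P/negP/negPn/eqP ->] := pselect (A !=set0).
  by apply: lb_le_inf => // _ [y [z [_ _ _ ->]]]; exact: sqrtr_ge0.
by rewrite inf0.
Qed.

Lemma interpD m x x' : (0 < m)%N -> c0 x -> c0 x' ->
  I m (x + x') <= I m x + I m x'.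
Proof.
move=> m0 xc xc'; apply/ler_addgt0Pr => e e0.
have e2 : 0 < e / 2 by rewrite divr_gt0.
have [y [z [yc zF xE h]]] := interp_approx m0 xc e2.
have [y' [z' [yc' zF' xE' h']]] := interp_approx m0 xc' e2.
have [zzF zz] := sln_add hF zF zF'.
have yyc := c0D yc yc'.
apply: le_trans (interp_le (y := y + y') (z := z + z') (m := m) yyc zzF _) _.
  by rewrite xE xE' !scalerDr addrACA.
apply: (@le_trans _ _ (Num.sqrt ((sup_norm y + sup_norm y') ^+ 2 + (pF z + pF z') ^+ 2))).
  apply: ler_wsqrtr; apply: lerD; rewrite lerXn2r ?nnegrE //.
  - exact: sup_norm_ge0.
  - by rewrite addr_ge0 // sup_norm_ge0.
  - apply: sup_norm_le => i; rewrite fctE (le_trans (ler_normD _ _)) //.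
    by rewrite lerD // le_sup_norm.
  - exact: sln_ge0.
  by rewrite addr_ge0 // sln_ge0.
apply: le_trans (minkowski2 _ _ _ _) _; lra.
Qed.

(** A decomposition of [x'], multiplied coordinatewise by the quotient [g = x / x'] with [|g| <= c],
    decomposes [x]; the sup norm and [pF] grow at most by the factor [c]. *)
Lemma interp_dom m (c : R) x x' : (0 < m)%N -> 0 <= c -> c0 x' ->
  (forall i, `|x i| <= c * `|x' i|) -> I m x <= c * I m x'.
Proof.
move=> m0 c_ge0 xc' xx'; apply/ler_addgt0Pr => e e0.
(* [c] may be zero, so the error is divided by [c + 1]. *)
have c1 : 0 < c + 1 by rewrite ltr_wpDl.
have [y' [z' [yc' zF' xE' h]]] := interp_approx m0 xc' (divr_gt0 e0 c1).
pose g i := if x' i == 0 then 0 else x i / x' i.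
have gx i : x i = g i * x' i.
  rewrite /g; case: eqP => [x0|/eqP x0]; last by rewrite divfK.
  by apply/eqP; have := xx' i; rewrite x0 normr0 mulr0 normr_le0 mul0r.
have gc i : `|g i| <= c.
  rewrite /g; case: eqP => [_|/eqP x0]; first by rewrite normr0.
  by rewrite normf_div ler_pdivrMr ?normr_gt0.
pose y i := g i * y' i; pose z i := g i * z' i.
have yy' i : `|y i| <= c * `|y' i| by rewrite normrM ler_wpM2r.
have yc : c0 y by exact: (c0_dom (c := c) yc').
have [zF zz'] : F z /\ pF z <= c * pF z'.
  by apply: (sln_dom hF) => // i; rewrite normrM ler_wpM2r.
apply: le_trans (interp_le (y := y) (z := z) (m := m) yc zF _) _.
  by apply/funext => i; rewrite gx xE' !fctE /y /z mulrDr !scalerAr.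
apply: (@le_trans _ _ (Num.sqrt ((c * sup_norm y') ^+ 2 + (c * pF z') ^+ 2))).
  apply: ler_wsqrtr; apply: lerD; rewrite lerXn2r ?nnegrE //.
  - exact: sup_norm_ge0.
  - by rewrite mulr_ge0 // sup_norm_ge0.
  - by apply: sup_norm_le => i; rewrite (le_trans (yy' i)) // ler_wpM2l // le_sup_norm.
  - exact: sln_ge0.
  by rewrite mulr_ge0 // sln_ge0.
rewrite !exprMn -mulrDr sqrtrM ?sqr_ge0 // sqrtr_sqr ger0_norm //.
apply: (@le_trans _ _ (c * (I m x' + e / (c + 1)))); first by rewrite ler_wpM2l // ltW.
rewrite mulrDr lerD2l mulrCA ler_piMr ?(ltW e0) // ler_pdivrMr // mul1r.
by rewrite lerDl.
Qed.

Lemma interpZ m (a : R) x : (0 < m)%N -> c0 x -> I m (a *: x) = `|a| * I m x.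
Proof.
move=> m0 xc; apply/le_anti/andP; split.
  by apply: interp_dom => // i; rewrite normrM.
have [->|a0] := eqVneq a 0; first by rewrite normr0 mul0r interp_ge0.
rewrite -ler_pdivlMl ?normr_gt0 // -normfV.
apply: interp_dom => //; first exact: c0Z.
by move=> i; rewrite normfV normrM mulKf // normr_eq0.
Qed.

Lemma interp_perm m (sigma : nat -> nat) x : (0 < m)%N -> bijective sigma ->
  c0 x -> I m (x \o sigma) <= I m x.
Proof.
move=> m0 sb xc; apply/ler_addgt0Pr => e e0.
have [y [z [yc zF xE /ltW h]]] := interp_approx m0 xc e0.
have [zsF zs] := sln_perm hF sb zF; have ysc := c0_perm sb yc.
apply: le_trans h.
apply: le_trans (interp_le (m := m) ysc zsF _) _; first by rewrite xE.
apply: ler_wsqrtr; apply: lerD; rewrite lerXn2r ?nnegrE ?sup_norm_ge0 ?sln_ge0 //.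
by apply: sup_norm_le => i; exact: (le_sup_norm (sigma i) yc).
Qed.

Lemma interp_coord m x i : (0 < m)%N -> c0 x ->
  `|x i| <= (m%:R^-1 + m%:R) * I m x.
Proof.
move=> m0 xc; have mR : 0 < m%:R :> R by rewrite ltr0n.
have k0 : 0 < m%:R^-1 + m%:R :> R by rewrite addr_gt0 ?invr_gt0.
rewrite -ler_pdivrMl //; apply/ler_addgt0Pr => e e0.
have [y [z [yc zF xE /ltW h]]] := interp_approx m0 xc e0.
apply: le_trans h; rewrite ler_pdivrMl // {1}xE fctE.
apply: le_trans (ler_normD _ _) _; rewrite mulrDl lerD // normrM.
  rewrite ger0_norm ?invr_ge0 ?(ltW mR) // ler_pM2l ?invr_gt0 //.
  apply: le_trans (le_sup_norm i yc) _.
  rewrite -[leLHS]ger0_norm ?sup_norm_ge0 // -sqrtr_sqr.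
  by apply: ler_wsqrtr; rewrite lerDl sqr_ge0.
rewrite ger0_norm ?(ltW mR) // ler_pM2l //.
apply: le_trans (sln_coord hF i zF) _.
rewrite -[leLHS]ger0_norm ?sln_ge0 // -sqrtr_sqr.
by apply: ler_wsqrtr; rewrite lerDr sqr_ge0.
Qed.

Lemma interp_le_sup m (c : R) x : (0 < m)%N -> c0 x ->
  (forall i, `|x i| <= c) -> I m x <= m%:R * c.
Proof.
move=> m0 xc xB; have mR : 0 < m%:R :> R by rewrite ltr0n.
have c_ge0 : 0 <= c by apply: le_trans (xB 0%N).
apply: le_trans (interp_le (y := m%:R *: x) (z := 0) (m := m) (c0Z _ xc) sln0.1 _) _.
  by rewrite scaler0 addr0 scalerA mulVf ?scale1r // gt_eqF.
rewrite sln0.2 expr0n addr0 sqrtr_sqr ger0_norm; last exact/sup_norm_ge0/c0Z.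
by apply: sup_norm_le => i; rewrite normrM gtr0_norm // ler_pM2l.
Qed.

Lemma interp_le_F m x : (0 < m)%N -> F x -> I m x <= m%:R^-1 * pF x.
Proof.
move=> m0 xF; have mR : 0 < m%:R :> R by rewrite ltr0n.
have mV : 0 <= m%:R^-1 :> R by rewrite invr_ge0 ltW.
have [zF zx] : F (m%:R^-1 *: x) /\ pF (m%:R^-1 *: x) <= m%:R^-1 * pF x.
  by apply: (sln_dom hF) => // i; rewrite normrM ger0_norm.
apply: le_trans (interp_le (y := 0) (z := m%:R^-1 *: x) (m := m) c0_zero zF _) _.
  by rewrite scaler0 add0r scalerA divff ?scale1r // gt_eqF.
have -> : sup_norm 0 = 0 :> R.
  apply/le_anti; rewrite sup_norm_ge0 ?andbT; last exact: c0_zero.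
  by apply: sup_norm_le => i; rewrite normr0.
by rewrite expr0n add0r sqrtr_sqr ger0_norm // sln_ge0.
Qed.

(** In an almost optimal decomposition [x = y / m + m z], the first term is at most
    [(B + 1) / m <= e / 2]. Hence [|z i| >= e / (2 m)] on [s], and [sln_count], applied to the
    multiple of [z] by [2 m / e], limits the size of [s]. *)
Lemma interp_count (B e : R) m : (0 < m)%N -> 2 * (B + 1) <= e * m%:R ->
  exists n, forall x s, c0 x -> I m x <= B -> uniq s ->
    (forall i, i \in s -> e <= `|x i|) -> (size s < n)%N.
Proof.
move=> m0 Bm; have mR : 0 < m%:R :> R by rewrite ltr0n.
have [B0|B0] := ltP B 0.
  by exists 0%N => x s _ IB; have := interp_ge0 m x; lra.
have e0 : 0 < e by rewrite -(pmulr_lgt0 _ mR) (lt_le_trans _ Bm) // mulr_gt0 //; lra.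
have [n hn] := sln_count hF ((B + 1) * (2 * m%:R / e)).
exists n => x s xc IB us xs; rewrite ltnNge; apply/negP => ns.
have [y [z [yc zF xE h]]] := interp_approx m0 xc ltr01.
have yB : sup_norm y <= B + 1.
  apply: (@le_trans _ _ (I m x + 1)); last by rewrite lerD2r.
  apply: le_trans (ltW h).
  rewrite -[leLHS]ger0_norm ?sup_norm_ge0 // -sqrtr_sqr.
  by apply: ler_wsqrtr; rewrite lerDl sqr_ge0.
have zB : pF z <= B + 1.
  apply: (@le_trans _ _ (I m x + 1)); last by rewrite lerD2r.
  apply: le_trans (ltW h).
  rewrite -[leLHS]ger0_norm ?sln_ge0 // -sqrtr_sqr.
  by apply: ler_wsqrtr; rewrite lerDr sqr_ge0.
have k0 : 0 < 2 * m%:R / e by rewrite divr_gt0 // mulr_gt0.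
have [wF wz] : F ((2 * m%:R / e) *: z) /\
    pF ((2 * m%:R / e) *: z) <= (2 * m%:R / e) * pF z.
  by apply: (sln_dom hF) => //; [exact: ltW|move=> i; rewrite normrM gtr0_norm].
suff w1 i : i \in s -> 1 <= `|((2 * m%:R / e) *: z) i|.
  have := lt_le_trans (hn _ s wF us ns w1) wz.
  by rewrite mulrC ltr_pM2l // ltNge zB.
move=> /xs; rewrite xE fctE => ei.
rewrite normrM gtr0_norm // -ler_pdivrMl // mulr1 invf_div ler_pdivrMr ?mulr_gt0 //.
have := le_trans ei (ler_normD _ _); rewrite !normrM normfV (gtr0_norm mR).
have y1 : m%:R^-1 * `|y i| <= e / 2.
  rewrite ler_pdivrMl // (le_trans (le_trans (le_sup_norm i yc) yB)) //; lra.
lra.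
Qed.

End interpolation.

(** * Midpoint-tight sequences and square suprema of seminorms *)

Lemma le_of_sqr (R : realDomainType) (a b : R) : 0 <= a -> 0 <= b ->
  a ^+ 2 <= b ^+ 2 -> a <= b.
Proof. by move=> a0 b0; rewrite ler_pXn2r // nnegrE. Qed.

Definition seminorm_on (R : realType) (E : lmodType R) (V : set E) (p : E -> R) :=
  [/\ forall x, V x -> 0 <= p x,
      forall (a : R) x, V x -> p (a *: x) = `|a| * p x &
      forall x y, V x -> V y -> p (x + y) <= p x + p y].

(** Nonnegative for a seminorm, and additive under sums of squares of seminorms: smallness for the
    whole norm passes to each constituent. *)
Definition convexity_gap (R : realType) (E : lmodType R) (p : E -> R) x y : R :=
  2 * p x ^+ 2 + 2 * p y ^+ 2 - p (x + y) ^+ 2.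

(** Used with two choices of [A]: initial segments give the l_2 sum of a family of seminorms, lists
    of [M] distinct indices the l_2 norm of the [M] largest coordinates. *)
Definition square_sup (R : realType) (E : Type) (A : set (seq nat))
    (n : nat -> E -> R) (x : E) : R :=
  Num.sqrt (sup [set \sum_(i <- s) n i x ^+ 2 | s in A]).

Section square_sup.
Context {R : realType} {E : lmodType R} {V : set E}.
Hypothesis Vlin : linear_subspace V.
Implicit Types (x y : E) (s : seq nat) (p : E -> R).

Lemma subspaceD x y : V x -> V y -> V (x + y).
Proof. by move=> Vx Vy; rewrite -[x]scale1r; exact: Vlin.2. Qed.

Lemma subspaceZ (a : R) x : V x -> V (a *: x).
Proof. by move=> Vx; rewrite -[_ *: _]addr0; apply: Vlin.2 => //; exact: Vlin.1. Qed.

Lemma subspaceB x y : V x -> V y -> V (x - y).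
Proof. by move=> Vx Vy; rewrite addrC -scaleN1r; exact: Vlin.2. Qed.

Lemma gap_ge_sqrB p x y : seminorm_on V p -> V x -> V y ->
  (p x - p y) ^+ 2 <= convexity_gap p x y.
Proof.
move=> [p0 _ pD] Vx Vy; rewrite /convexity_gap.
have h0 := p0 _ (subspaceD Vx Vy); have h1 := pD _ _ Vx Vy.
have : p (x + y) ^+ 2 <= (p x + p y) ^+ 2.
  by rewrite lerXn2r ?nnegrE // addr_ge0 // p0.
lra.
Qed.

(** The right side minus the left side is [(p x - p y)^2 + 2 p (x + y) (p x + p y - p (x + y))]. *)
Lemma gap_ge_sqr_defect p x y : seminorm_on V p -> V x -> V y ->
  (p x + p y - p (x + y)) ^+ 2 <= convexity_gap p x y.
Proof.
move=> [p0 _ pD] Vx Vy; rewrite /convexity_gap.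
have h0 := p0 _ (subspaceD Vx Vy); have h1 := pD _ _ Vx Vy.
have : p (x + y) * p (x + y) <= p (x + y) * (p x + p y) by rewrite ler_wpM2l.
have := sqr_ge0 (p x - p y).
lra.
Qed.

Lemma gap_ge0 p x y : seminorm_on V p -> V x -> V y -> 0 <= convexity_gap p x y.
Proof. by move=> ps Vx Vy; apply: le_trans (gap_ge_sqrB ps Vx Vy); exact: sqr_ge0. Qed.

Definition midpoint_tight p (u : nat -> E) :=
  forall e : R, 0 < e -> exists n0, forall m n, (n0 <= m)%N -> (n0 <= n)%N ->
    convexity_gap p (u m) (u n) <= e.

Lemma midpoint_tightP p (u : nat -> E) : seminorm_on V p -> (forall n, V (u n)) ->
  midpoint_tight p u ->
  forall e : R, 0 < e -> exists n0, forall m n, (n0 <= m)%N -> (n0 <= n)%N ->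
    `|p (u m) - p (u n)| <= e /\ p (u m) + p (u n) - p (u m + u n) <= e.
Proof.
move=> ps Vu pu e e0; have [n0 hn0] := pu _ (exprn_gt0 2 e0).
exists n0 => m n n0m n0n; have h := hn0 m n n0m n0n.
have key (t : R) : t ^+ 2 <= e ^+ 2 -> `|t| <= e.
  move=> te; rewrite -(ler_pXn2r (n := 2)) ?nnegrE ?(ltW e0) //.
  by rewrite real_normK ?num_real.
split; first by apply: key; exact: le_trans (gap_ge_sqrB ps (Vu m) (Vu n)) h.
apply: le_trans (ler_norm _) _; apply: key.
exact: le_trans (gap_ge_sqr_defect ps (Vu m) (Vu n)) h.
Qed.

Section family.
Context {A : set (seq nat)} {n : nat -> E -> R}.
Hypothesis A0 : A !=set0.
Hypothesis nsemi : forall i, seminorm_on V (n i).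
Hypothesis nbdd : forall x, V x -> has_ubound [set \sum_(i <- s) n i x ^+ 2 | s in A].

Local Notation q := (square_sup A n).

Lemma sum_sqr_ge0 s x : 0 <= \sum_(i <- s) n i x ^+ 2.
Proof. by apply: sumr_ge0 => i _; exact: sqr_ge0. Qed.

Lemma square_sup_ge s x : V x -> A s -> \sum_(i <- s) n i x ^+ 2 <= q x ^+ 2.
Proof.
move=> Vx As; have h : \sum_(i <- s) n i x ^+ 2 <= sup [set \sum_(i <- s) n i x ^+ 2 | s in A].
  by apply: ub_le_sup; [exact: nbdd|exists s].
by rewrite sqr_sqrtr // (le_trans _ h) // sum_sqr_ge0.
Qed.

Lemma square_sup_ge0 x : 0 <= q x.
Proof. exact: sqrtr_ge0. Qed.

Lemma square_sup_le (B : R) x : 0 <= B ->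
  (forall s, A s -> \sum_(i <- s) n i x ^+ 2 <= B) -> q x ^+ 2 <= B.
Proof.
move=> B0 h; rewrite /square_sup; set S := sup _.
have SB : S <= B.
  apply: ge_sup => [|_ [s As <-]]; last exact: h.
  by have [s As] := A0; exists (\sum_(i <- s) n i x ^+ 2), s.
have [S0|S0] := leP 0 S; first by rewrite sqr_sqrtr.
by rewrite ltr0_sqrtr // expr0n.
Qed.

Lemma square_sup_adherent (e : R) x : 0 < e -> V x ->
  exists2 s, A s & q x ^+ 2 - e <= \sum_(i <- s) n i x ^+ 2.
Proof.
move=> e0 Vx.
have [|_ [s As <-] h] := sup_adherent e0 (E := [set \sum_(i <- s) n i x ^+ 2 | s in A]).
  split; last exact: nbdd.
  by have [s As] := A0; exists (\sum_(i <- s) n i x ^+ 2), s.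
exists s => //; rewrite sqr_sqrtr; first exact: ltW.
apply: le_trans (sum_sqr_ge0 s x) _.
by apply: ub_le_sup; [exact: nbdd|exists s].
Qed.

Lemma square_sup_seminorm : seminorm_on V q.
Proof.
have qZ (a : R) x : V x -> q (a *: x) <= `|a| * q x.
  move=> Vx; apply: le_of_sqr; rewrite ?mulr_ge0 ?square_sup_ge0 //.
  apply: square_sup_le => [|s As]; first exact: sqr_ge0.
  rewrite exprMn; apply: le_trans (ler_wpM2l (sqr_ge0 _) (square_sup_ge Vx As)).
  rewrite mulr_sumr; apply: ler_sum => i _.
  by have [_ -> //] := nsemi i; rewrite exprMn.
split=> [x _|a x Vx|x y Vx Vy]; first exact: square_sup_ge0.
- apply/le_anti; rewrite qZ //=.
  have [->|a0] := eqVneq a 0; first by rewrite normr0 mul0r square_sup_ge0.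
  rewrite -ler_pdivlMl ?normr_gt0 // -normfV.
  by have := qZ a^-1 _ (subspaceZ a Vx); rewrite scalerA mulVf // scale1r.
apply: le_of_sqr; rewrite ?addr_ge0 ?square_sup_ge0 //.
apply: square_sup_le => [|s As]; first exact: sqr_ge0.
have h := minkowski s (fun i => n i x) (fun i => n i y).
apply: (@le_trans _ _ (\sum_(i <- s) (n i x + n i y) ^+ 2)).
  apply: ler_sum => i _; have [p0 _ pD] := nsemi i.
  by rewrite lerXn2r ?nnegrE ?addr_ge0 ?p0 ?pD //; exact: subspaceD.
have r_le z : V z -> Num.sqrt (\sum_(i <- s) n i z ^+ 2) <= q z.
  move=> Vz; apply: le_of_sqr; rewrite ?sqrtr_ge0 // sqr_sqrtr ?sum_sqr_ge0 //.
  exact: square_sup_ge.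
have S0 : 0 <= \sum_(i <- s) (n i x + n i y) ^+ 2.
  by apply: sumr_ge0 => i _; exact: sqr_ge0.
rewrite -[leLHS]sqr_sqrtr // lerXn2r ?nnegrE ?addr_ge0 ?sqrtr_ge0 //.
by apply: le_trans h _; rewrite lerD // r_le.
Qed.

End family.

Lemma sum_halves (k : nat) : \sum_(i < k) (2^-1 : R) ^+ i <= 2.
Proof.
suff : \sum_(i < k) (2^-1 : R) ^+ i + 2 * 2^-1 ^+ k = 2.
  have : 0 <= (2^-1 : R) ^+ k by rewrite exprn_ge0 // invr_ge0.
  lra.
elim: k => [|k IH]; first by rewrite big_ord0 expr0 mulr1 add0r.
by rewrite big_ord_recr /= exprS -[RHS]IH; field.
Qed.

(** * Weighted l_2 sums of countably many seminorms *)

Section weighted.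
Context {n : nat -> E -> R} {P : E -> R}.
Hypothesis Psemi : seminorm_on V P.
Hypothesis nsemi : forall i, seminorm_on V (n i).
Hypothesis nP : forall i x, V x -> n i x <= 2^-1 ^+ i * P x.

Let A : set (seq nat) := range (iota 0).
Local Notation q := (square_sup A n).

Lemma initial_nonempty : A !=set0. Proof. by exists (iota 0 0), 0%N. Qed.

Lemma weighted_le s x : V x -> A s -> \sum_(i <- s) n i x ^+ 2 <= 2 * P x ^+ 2.
Proof.
move=> Vx [k _ <-].
have -> : iota 0 k = index_iota 0 k by rewrite /index_iota subn0.
rewrite big_mkord.
apply: le_trans (ler_wpM2r (sqr_ge0 _) (sum_halves k)).
rewrite mulr_suml; apply: ler_sum => i _.
have [P0 _ _] := Psemi; have [n0 _ _] := nsemi i.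
have h0 : 0 <= (2^-1 : R) ^+ i by rewrite exprn_ge0 // invr_ge0.
apply: (@le_trans _ _ ((2^-1 ^+ i * P x) ^+ 2)).
  by rewrite lerXn2r ?nnegrE ?mulr_ge0 ?n0 ?P0 ?nP.
rewrite exprMn ler_wpM2r ?sqr_ge0 // expr2 ler_piMr //.
by rewrite exprn_ile1 ?invr_ge0 // invf_le1 ?ler1n.
Qed.

Lemma weighted_bdd x : V x -> has_ubound [set \sum_(i <- s) n i x ^+ 2 | s in A].
Proof. by move=> Vx; exists (2 * P x ^+ 2) => _ [s As <-]; exact: weighted_le. Qed.

Lemma weighted_seminorm : seminorm_on V q.
Proof. exact: (square_sup_seminorm initial_nonempty nsemi weighted_bdd). Qed.

Lemma weighted_sup_le x : V x -> q x <= 2 * P x.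
Proof.
move=> Vx; have [P0 _ _] := Psemi.
have qP : q x ^+ 2 <= 2 * P x ^+ 2.
  apply: (square_sup_le initial_nonempty) => [|s As]; last exact: weighted_le.
  by rewrite mulr_ge0 // sqr_ge0.
rewrite -(ler_pXn2r (n := 2)) ?nnegrE ?square_sup_ge0 ?mulr_ge0 ?P0 //.
have := sqr_ge0 (P x); lra.
Qed.

Lemma weighted_sup_ge i x : V x -> n i x <= q x.
Proof.
move=> Vx; have [n0 _ _] := nsemi i.
rewrite -(ler_pXn2r (n := 2)) ?nnegrE ?square_sup_ge0 ?n0 //.
apply: le_trans (square_sup_ge weighted_bdd Vx (s := iota 0 i.+1) _); last by exists i.+1.
have -> : iota 0 i.+1 = index_iota 0 i.+1 by rewrite /index_iota subn0.
rewrite big_mkord big_ord_recr /= lerDr.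
by apply: sumr_ge0 => j _; exact: sqr_ge0.
Qed.

(** On a finite segment the gap of the l_2 sum is the sum of the gaps of its terms, all nonnegative,
    so it dominates each of them. *)
Lemma weighted_gap i x y : V x -> V y ->
  convexity_gap (n i) x y <= convexity_gap q x y.
Proof.
move=> Vx Vy; rewrite {2}/convexity_gap lerBrDr.
have g0 j : 0 <= convexity_gap (n j) x y by exact: gap_ge0.
suff : q (x + y) ^+ 2 <= 2 * q x ^+ 2 + 2 * q y ^+ 2 - convexity_gap (n i) x y by lra.
set B := _ - _.
have key s : A s -> \sum_(j <- s) n j (x + y) ^+ 2 <= B.
  (* The segment is enlarged to contain [i], which only increases the sum to be bounded. *)
  move=> [k _ <-]; pose l := maxn k i.+1.
  have h z : V z -> \sum_(j <- iota 0 l) n j z ^+ 2 <= q z ^+ 2.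
    by move=> Vz; apply: (square_sup_ge weighted_bdd Vz); exists l.
  have {h} := conj (h x Vx) (h y Vy).
  have iotaE j : iota 0 j = index_iota 0 j by rewrite /index_iota subn0.
  rewrite !iotaE !big_mkord => -[hx hy].
  have hk : \sum_(j < k) n j (x + y) ^+ 2 <= \sum_(j < l) n j (x + y) ^+ 2.
    have kl : (k <= l)%N by exact: leq_maxl.
    rewrite (big_ord_widen _ (fun j => n j (x + y) ^+ 2) kl) [leRHS](bigID (fun j : 'I_l => (j < k)%N)) /=.
    by rewrite lerDl sumr_ge0 // => j _; exact: sqr_ge0.
  have il : (i < l)%N by exact: leq_maxr.
  have : convexity_gap (n i) x y <= \sum_(j < l) convexity_gap (n j) x y.
    by rewrite (bigD1 (Ordinal il)) //= lerDl sumr_ge0.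
  rewrite /convexity_gap sumrB big_split /= -!mulr_sumr /B /convexity_gap; lra.
apply: (square_sup_le initial_nonempty) => //.
by apply: le_trans (key (iota 0 0) _); [rewrite big_nil|exists 0%N].
Qed.

Lemma weighted_tight (u : nat -> E) : (forall k, V (u k)) ->
  midpoint_tight q u -> forall i, midpoint_tight (n i) u.
Proof.
move=> Vu qu i e e0; have [n0 hn0] := qu e e0; exists n0 => k l n0k n0l.
exact: le_trans (weighted_gap i (Vu k) (Vu l)) (hn0 k l n0k n0l).
Qed.

End weighted.
End square_sup.

(** * The l_2 norm of the largest coordinates *)

Section top_norm.
Context {R : realType}.
Implicit Types (x y : nat -> R) (s : seq nat) (M : nat).

Definition top_norm M : (nat -> R) -> R :=
  square_sup [set s | uniq s /\ size s = M] (fun i x => `|x i|).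

Let coord_semi i : seminorm_on (@c0 R) (fun x => `|x i|).
Proof.
by split=> [x _|a x _|x y _ _]; rewrite ?normr_ge0 ?normrM ?ler_normD.
Qed.

Let top_nonempty M : [set s : seq nat | uniq s /\ size s = M] !=set0.
Proof. by exists (iota 0 M); rewrite /= iota_uniq size_iota. Qed.

Let top_le M x s : c0 x -> [set s : seq nat | uniq s /\ size s = M] s ->
  \sum_(i <- s) `|x i| ^+ 2 <= M%:R * sup_norm x ^+ 2.
Proof.
move=> xc [_ <-]; rewrite -sum1_size natr_sum mulr_suml.
apply: ler_sum => i _; rewrite mul1r lerXn2r ?nnegrE ?sup_norm_ge0 //.
exact: le_sup_norm.
Qed.

Let top_bdd M x : c0 x -> has_ubound
  [set \sum_(i <- s) `|x i| ^+ 2 | s in [set s : seq nat | uniq s /\ size s = M]].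
Proof. by move=> xc; exists (M%:R * sup_norm x ^+ 2) => _ [s As <-]; exact: top_le. Qed.

Lemma c0_subspace : linear_subspace (@c0 R).
Proof. by split=> [|a x y xc yc]; [exact: c0_zero|apply/c0D => //; exact: c0Z]. Qed.

Lemma top_norm_seminorm M : seminorm_on (@c0 R) (top_norm M).
Proof.
exact: (square_sup_seminorm c0_subspace (top_nonempty M) coord_semi (@top_bdd M)).
Qed.

Lemma top_norm_le M x : c0 x -> top_norm M x <= M%:R * sup_norm x.
Proof.
move=> xc; have h : top_norm M x ^+ 2 <= M%:R * sup_norm x ^+ 2.
  apply: (square_sup_le (top_nonempty M)) => [|s As]; last exact: top_le.
  by rewrite mulr_ge0 // sqr_ge0.
rewrite -(ler_pXn2r (n := 2)) ?nnegrE ?square_sup_ge0 ?mulr_ge0 ?sup_norm_ge0 //.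
apply: le_trans h _; rewrite exprMn ler_wpM2r ?sqr_ge0 // -natrX ler_nat.
by case: M => // k; rewrite leq_pmulr.
Qed.

Lemma top_norm_dom M x y : c0 y -> (forall s, uniq s -> size s = M ->
    exists s', [/\ uniq s', size s' = M &
      \sum_(i <- s) `|x i| ^+ 2 <= \sum_(i <- s') `|y i| ^+ 2]) ->
  top_norm M x <= top_norm M y.
Proof.
move=> yc h; rewrite -(ler_pXn2r (n := 2)) ?nnegrE ?square_sup_ge0 //.
apply: (square_sup_le (top_nonempty M)) => [|s [us sM]]; first exact: sqr_ge0.
have [s' [us' sM' ss']] := h s us sM; apply: le_trans ss' _.
by apply: (square_sup_ge (@top_bdd M)).
Qed.

(* An almost optimal set [s] for [x + y] is almost optimal for [x] and [y], and
   [x] and [y] almost agree on it; a large coordinate of [x] outside [s] could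
   be exchanged against a small one inside. *)
Lemma top_norm_cauchy (u : nat -> nat -> R) : (forall n, c0 (u n)) ->
  (forall M, midpoint_tight (top_norm M) u) ->
  (forall e : R, 0 < e -> exists M, forall n s, uniq s ->
    (forall i, i \in s -> e <= `|u n i|) -> (size s < M)%N) ->
  forall e : R, 0 < e -> exists n0, forall m n, (n0 <= m)%N -> (n0 <= n)%N ->
    forall i, `|u m i - u n i| <= e.
Proof.
move=> uc utight ucount d d0.
(* Any [M] distinct indices include one where a given [u n] is below [d / 4]. *)
have [M hM] := ucount (d / 4) (divr_gt0 d0 (ltr0n _ 4)).
have e0 : 0 < d ^+ 2 / 8 by rewrite divr_gt0 // exprn_gt0.
have [n0 hn0] := utight M _ e0; exists n0 => m n n0m n0n i.
move: (hn0 m n n0m n0n); rewrite /convexity_gap.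
set x := u m; set y := u n => gap.
have xc : c0 x by exact: uc.
have yc : c0 y by exact: uc.
have [s [us sM] hs] := square_sup_adherent (top_nonempty M) (@top_bdd M) e0 (c0D xc yc).
rewrite -/(top_norm M _) in hs.
have hx : \sum_(j <- s) `|x j| ^+ 2 <= top_norm M x ^+ 2 by exact: (square_sup_ge (@top_bdd M)).
have hy : \sum_(j <- s) `|y j| ^+ 2 <= top_norm M y ^+ 2 by exact: (square_sup_ge (@top_bdd M)).
(* Parallelogram identity on [s]. Together with the small gap and the choice of [s], it bounds the
   left side by [d^2 / 4], and the loss of [s] against the optimum for [x] and for [y] by
   [d^2 / 8]. *)
have para : \sum_(j <- s) `|x j - y j| ^+ 2 = 2 * \sum_(j <- s) `|x j| ^+ 2 +
    2 * \sum_(j <- s) `|y j| ^+ 2 - \sum_(j <- s) `|(x + y) j| ^+ 2.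
  rewrite !mulr_sumr -big_split /= -sumrB; apply: eq_bigr => j _.
  by rewrite fctE !real_normK ?num_real //; ring.
have xy0 : 0 <= \sum_(j <- s) `|x j - y j| ^+ 2.
  by apply: sumr_ge0 => j _; exact: sqr_ge0.
case: (boolP (i \in s)) => [ins|nis].
  have : `|x i - y i| ^+ 2 <= \sum_(j <- s) `|x j - y j| ^+ 2.
    rewrite (perm_big _ (perm_to_rem ins)) big_cons lerDl.
    by apply: sumr_ge0 => j _; exact: sqr_ge0.
  move=> h; rewrite -(ler_pXn2r (n := 2)) ?nnegrE ?(ltW d0) //.
  have := sqr_ge0 d; lra.
(* Exchanging a coordinate below [d / 4] in [s] for one above [d / 2] outside would gain more than
   [3 d^2 / 16], whereas [s] is within [d^2 / 8] of the optimum. *)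
have out w k : w = u k -> \sum_(j <- s) `|w j| ^+ 2 >= top_norm M w ^+ 2 - d ^+ 2 / 8 ->
    `|w i| <= d / 2.
  move=> wE hw; have wc : c0 w by rewrite wE; exact: uc.
  rewrite leNgt; apply/negP => wi.
  have [j js wj] : exists2 j, j \in s & `|w j| < d / 4.
    apply: contrapT => nj; suff : (size s < M)%N by rewrite sM ltnn.
    apply: (hM k) => // j js; rewrite leNgt -wE; apply/negP => wj.
    by apply: nj; exists j.
  have us' : uniq (i :: rem j s) by rewrite /= rem_uniq // andbT; apply: contra nis => /mem_rem.
  have sM' : size (i :: rem j s) = M.
    by rewrite /= size_rem // prednK // -has_predT; apply/hasP; exists j.
  have := square_sup_ge (@top_bdd M) wc (conj us' sM').
  rewrite big_cons -/(top_norm M w).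
  have : \sum_(l <- s) `|w l| ^+ 2 = `|w j| ^+ 2 + \sum_(l <- rem j s) `|w l| ^+ 2.
    by rewrite (perm_big _ (perm_to_rem js)) big_cons.
  move: hw; set S1 := \sum_(l <- s) _; set S2 := \sum_(l <- rem j s) _ => hw S1E h.
  have : (d / 2) ^+ 2 < `|w i| ^+ 2.
    by rewrite ltrXn2r ?nnegrE // ltW // divr_gt0.
  have : `|w j| ^+ 2 <= (d / 4) ^+ 2.
    by rewrite lerXn2r ?nnegrE ?(ltW wj) // ltW // divr_gt0.
  have := exprn_gt0 2 d0; rewrite !exprMn; lra.
rewrite (le_trans (ler_normB _ _)) // [leRHS]splitr lerD //.
  by apply: (out x m) => //; lra.
by apply: (out y n) => //; lra.
Qed.

End top_norm.

(** * Series in the completion *)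

Lemma real_cauchy_limit (R : realType) (v : nat -> R) :
  (forall e : R, 0 < e -> exists n0, forall m n, (n0 <= m)%N -> (n0 <= n)%N ->
    `|v m - v n| <= e) ->
  v @ \oo --> limn v.
Proof.
move=> vc; apply/cauchy_cvgP/cauchy_exP => e e0.
have [n0 hn0] := vc _ (divr_gt0 e0 (ltr0n _ 2)).
exists (v n0), n0 => // n /= n0n; rewrite /ball /=.
apply: le_lt_trans (hn0 _ _ (leqnn _) n0n) _.
by rewrite ltr_pdivrMr // ltr_pMr // ltr1n.
Qed.

Section completion.
Context {R : realType} {N : (nat -> R) -> R} {T : completeNormedModType R}
  {iota : (nat -> R) -> T}.
Hypothesis hN : figiel_johnson_norm N.
Hypothesis hT : is_completion (@c00 R) N iota.
Implicit Types (v : nat -> R) (K : nat).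

Lemma iota_series v K :
  series (fun n => v n *: iota (unit_vec R n)) K = iota (restr 0 K v).
Proof.
have [lin _ _] := hT.
have c0 : c00 (0 : nat -> R) by apply/c00P; exists 0%N.
have iota0 : iota 0 = 0.
  by have := lin (-1) 0 0 c0 c0; rewrite scaler0 addr0 scaleN1r addNr.
elim: K => [|K IH].
  by rewrite /series /= big_geq // restr_geq // iota0.
rewrite /series /= big_nat_recr //= -[\sum_(0 <= i < K) _]/(series _ K) IH.
rewrite addrC -lin; [congr iota|exact: c00_unit|exact: c00_restr].
apply/funext => i; rewrite !fctE /restr /unit_vec ltnS /=.
by case: ltngtP => [_|_|->]; rewrite ?scaler0 ?add0r // [_ *: 1]mulr1 addr0.
Qed.

Lemma norm_iota_series v K :
  `|series (fun n => v n *: iota (unit_vec R n)) K| = N (restr 0 K v).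
Proof. by have [_ nrm _] := hT; rewrite iota_series nrm //; exact: c00_restr. Qed.

Lemma restr_norm_nondecreasing v : nondecreasing_seq (fun K => N (restr 0 K v)).
Proof.
move=> k l kl; apply: (fj_mono hN) => [|i]; first exact: c00_restr.
rewrite /restr /=; case: ifP => [ik|_]; last by rewrite normr0.
by rewrite (leq_trans ik kl).
Qed.

Lemma cvg_norm_iota_series v :
  cvgn (series (fun n => v n *: iota (unit_vec R n))) ->
  N (restr 0 K v) @[K --> \oo] -->
    `|limn (series (fun n => v n *: iota (unit_vec R n)))|.
Proof.
move=> cv; under eq_fun do rewrite -norm_iota_series.
exact: cvg_norm.
Qed.

(** Bounded completeness of the basis: [fj_restr_small] makes the partial sums Cauchy. Conversely,
    the norms of the sections are nondecreasing, hence bounded by their limit. *)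
Lemma cvg_iota_series v :
  cvgn (series (fun n => v n *: iota (unit_vec R n))) <-> fj_bounded N v.
Proof.
split=> [cv|vb].
  have nc := cvg_norm_iota_series cv.
  have nc' : cvgn (fun K => N (restr 0 K v)) by apply/cvg_ex; eexists; exact: nc.
  have [] // := @fj_ext_le _ N (limn (fun K => N (restr 0 K v))) v.
  exact: nondecreasing_cvgn_le (restr_norm_nondecreasing v) nc'.
apply/cauchy_cvgP/cauchy_exP => e e0.
have [K hK] := fj_restr_small hN vb (divr_gt0 e0 (ltr0n _ 2)).
exists (series (fun n => v n *: iota (unit_vec R n)) K), K => // l /= Kl.
have [lin nrm _] := hT; rewrite -ball_normE /= distrC !iota_series addrC -scaleN1r.
rewrite -lin; try exact: c00_restr.
rewrite nrm; last by apply: c00D; [apply: c00Z|]; exact: c00_restr.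
have -> : -1 *: restr 0 K v + restr 0 l v = restr K l v.
  apply/funext => i; rewrite !fctE /restr /= scaleN1r.
  have [iK|Ki] := ltnP i K; last by rewrite oppr0 add0r.
  by rewrite (leq_trans iK Kl) addNr.
apply: le_lt_trans (hK _ _ (leqnn K)) _.
by rewrite ltr_pdivrMr // ltr_pMr // ltr1n.
Qed.

Lemma norm_lim_iota_series v : fj_bounded N v ->
  `|limn (series (fun n => v n *: iota (unit_vec R n)))| = fj_ext N v.
Proof.
move=> vb; have cv := (cvg_iota_series v).2 vb.
have nc := cvg_norm_iota_series cv.
have nc' : cvgn (fun K => N (restr 0 K v)) by apply/cvg_ex; eexists; exact: nc.
rewrite -(cvg_lim _ nc) //; apply/le_anti/andP; split.
  by apply: limr_le => //; near=> K; exact: le_fj_ext.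
have [] // := @fj_ext_le _ N (limn (fun K => N (restr 0 K v))) v.
exact: nondecreasing_cvgn_le (restr_norm_nondecreasing v) nc'.
Unshelve. all: by end_near. Qed.

End completion.

(** * The interpolation space *)

Section interpolation_space.
Context {R : realType} {N : (nat -> R) -> R} {F : set (nat -> R)}
  {pF : (nat -> R) -> R}.
Hypothesis hN : figiel_johnson_norm N.
Hypothesis hF : symmetric_lattice_norm F pF.
Implicit Types (x y : nat -> R) (s : seq nat) (i j k n : nat).

Definition interp_seq (G : set (nat -> R)) (p : (nat -> R) -> R) x : nat -> R :=
  fun n => interp_norm G p (2 ^ n.+1) x.

Local Notation a := (interp_seq F pF).
Local Notation M := (fj_ext N).
Local Notation bdd := (fj_bounded N).

(** The space [Y] described without the completion; [cvg_iota_series] identifies the two. *)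
Definition interp_space : set (nat -> R) := [set x | c0 x /\ bdd (a x)].
Definition interp_space_norm x : R := M (a x).

Local Notation W := interp_space.
Local Notation P := interp_space_norm.

Let m_gt0 n : (0 < 2 ^ n.+1)%N. Proof. by rewrite expn_gt0. Qed.

Lemma interp_seq_ge0 x n : 0 <= a x n.
Proof. exact: interp_ge0. Qed.

Lemma norm_interp_seq x n : `|a x n| = a x n.
Proof. by rewrite ger0_norm // interp_seq_ge0. Qed.

Lemma interp_seqD x y n : c0 x -> c0 y -> a (x + y) n <= a x n + a y n.
Proof. by move=> xc yc; exact: interpD. Qed.

Lemma interp_seqZ (t : R) x : c0 x -> a (t *: x) = `|t| *: a x.
Proof. by move=> xc; apply/funext => n; rewrite fctE; exact: interpZ. Qed.

Lemma interp_seq_dom (c : R) x y n : 0 <= c -> c0 y ->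
  (forall i, `|x i| <= c * `|y i|) -> a x n <= c * a y n.
Proof. by move=> c_ge0 yc xy; exact: interp_dom. Qed.

Lemma interp_space_dom (c : R) x y : 0 <= c -> W y ->
  (forall i, `|x i| <= c * `|y i|) -> W x /\ P x <= c * P y.
Proof.
move=> c_ge0 [yc yb] xy; have xc : c0 x by exact: (c0_dom (c := c) yc).
have [] := @fj_ext_mono _ _ hN (a x) (c *: a y).
- exact: fj_bddZ.
- move=> i; rewrite norm_interp_seq fctE ger0_norm ?interp_seq_dom //.
  by rewrite mulr_ge0 // interp_seq_ge0.
by rewrite fj_extZ // ger0_norm.
Qed.

Lemma interp_spaceD x y : W x -> W y -> W (x + y) /\ P (x + y) <= P x + P y.
Proof.
move=> [xc xb] [yc yb]; have xyc := c0D xc yc.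
have [] := @fj_ext_mono _ _ hN (a (x + y)) (a x + a y).
- exact: fj_bddD.
- move=> i; rewrite norm_interp_seq fctE ger0_norm ?interp_seqD //.
  by rewrite addr_ge0 // interp_seq_ge0.
move=> xyb h; split=> //; apply: le_trans h _; exact: fj_ext_le_add.
Qed.

Lemma interp_spaceZ (t : R) x : W x -> W (t *: x) /\ P (t *: x) = `|t| * P x.
Proof.
move=> [xc xb]; split; last by rewrite /P interp_seqZ // fj_extZ // normr_id.
split; first exact: c0Z.
by rewrite interp_seqZ //; exact: fj_bddZ.
Qed.

(** The decomposition with [y = 0] bounds the [i]-th interpolation norm by
    [2^-(i+1) * pF (unit_vec R n)], which is summable in [i]. *)
Lemma interp_space_unit n : W (unit_vec R n).
Proof.
split; first exact: c0_unit.
have Fn := sln_unit hF n; have p0 := sln_ge0 hF Fn.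
have [] // := @fj_ext_le _ N (2 * pF (unit_vec R n)) (a (unit_vec R n)) => K.
apply: le_trans (fj_le_coords hN _ _) _.
apply: le_trans (ler_wpM2r p0 (sum_halves K)).
rewrite mulr_suml; apply: ler_sum => i _.
apply: (@le_trans _ _ (a (unit_vec R n) i)).
  by rewrite norm_interp_seq ler_piMr ?interp_seq_ge0 // fj_unit_le1.
apply: le_trans (interp_le_F hF (m_gt0 i) Fn) _.
rewrite ler_wpM2r // natrX exprVn lef_pV2 ?posrE ?exprn_gt0 //.
by rewrite -!natrX ler_nat leq_exp2l.
Qed.

Lemma interp_space_lin : linear_subspace W.
Proof.
split=> [|t x y Wx Wy].
  have [] // := @interp_space_dom 0 0 (unit_vec R 0) (lexx 0) (interp_space_unit 0).
  by move=> i; rewrite normr0 mul0r.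
by apply: (interp_spaceD _ Wy).1; exact: (interp_spaceZ t Wx).1.
Qed.

Lemma interp_space_semi : seminorm_on W P.
Proof.
split=> [x [_ xb]|t x Wx|x y Wx Wy]; first exact: fj_ext_ge0.
  exact: (interp_spaceZ t Wx).2.
exact: (interp_spaceD Wx Wy).2.
Qed.

Lemma interp_space_coord x i : W x -> `|x i| <= 3 * P x.
Proof.
move=> [xc xb]; apply: le_trans (interp_coord hF i (m_gt0 0) xc) _.
have h : a x 0%N <= P x by rewrite -norm_interp_seq; exact: fj_ext_coord.
have h0 := interp_seq_ge0 x 0; rewrite -/(a x 0%N).
(* [interp_coord] with [m = 2] gives the constant [1 / 2 + 2], rounded up to 3. *)
have : (2 ^ 1)%:R^-1 + (2 ^ 1)%:R <= 3 :> R by rewrite expn1; lra.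
move=> h3; apply: le_trans (ler_wpM2r h0 h3) _; lra.
Qed.

Lemma interp_space_sup x : W x -> sup_norm x <= 3 * P x.
Proof. by move=> Wx; apply: sup_norm_le => i; exact: interp_space_coord. Qed.

Lemma interp_seq_perm (eps : nat -> bool) (sigma : nat -> nat) x n :
  bijective sigma -> c0 x ->
  a (fun i => (-1) ^+ eps i * x (sigma i)) n <= a x n.
Proof.
move=> sb xc; apply: le_trans (interp_perm hF (m_gt0 n) sb xc).
rewrite -[leRHS]mul1r; apply: interp_dom => //; first exact: c0_perm.
by move=> i; rewrite normrM normrX normrN1 expr1n.
Qed.

Lemma interp_space_perm (eps : nat -> bool) (sigma : nat -> nat) x :
  bijective sigma -> W x -> W (fun i => (-1) ^+ eps i * x (sigma i)).
Proof.
move=> sb [xc xb]; split.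
  apply: (c0_dom (c := 1) (c0_perm sb xc)) => i.
  by rewrite normrM normrX normrN1 expr1n.
have [] // := @fj_ext_mono _ _ hN
  (a (fun i => (-1) ^+ eps i * x (sigma i))) (a x) xb => i.
by rewrite !norm_interp_seq interp_seq_perm.
Qed.

Lemma interp_space_count (B e : R) : 0 < e -> exists n, forall x s, W x ->
  P x <= B -> uniq s -> (forall i, i \in s -> e <= `|x i|) -> (size s < n)%N.
Proof.
(* [2 ^ (j + 1)] is at least [2 (B + 1) / e], as [interp_count] requires, and the [j]-th
   interpolation norm is at most [P x]. *)
move=> e0; pose j := Num.truncn (2 * (B + 1) / e).
have [|n hn] := @interp_count _ _ _ hF B e (2 ^ j.+1) (m_gt0 j).
  rewrite [leRHS]mulrC -ler_pdivrMr // (le_trans (ltW (truncnS_gt _))) //.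
  by rewrite ler_nat ltnW // ltn_expl.
exists n => x s [xc xb] xB; apply: hn => //.
by apply: le_trans xB; rewrite -/(a x j) -norm_interp_seq; exact: fj_ext_coord.
Qed.

Lemma interp_seq_lip x y n : c0 x -> c0 y ->
  `|a x n - a y n| <= a (x - y) n.
Proof.
move=> xc yc.
have mB (u v : nat -> R) : c0 u -> c0 v -> a u n - a v n <= a (u - v) n.
  move=> uc vc; rewrite lerBlDr; apply: le_trans (interp_seqD _ _ vc).
    by rewrite subrK.
  by apply: c0D => //; rewrite -scaleN1r; exact: c0Z.
rewrite ler_norml mB // andbT lerNl opprB; apply: le_trans (mB _ _ yc xc) _.
have E : y - x = -1 *: (x - y) by rewrite scaleN1r opprB.
rewrite E interp_seqZ; last by apply: c0D => //; rewrite -scaleN1r; exact: c0Z.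
by rewrite normrN1 scale1r.
Qed.

Lemma interp_seq_small i (e : R) (u : nat -> nat -> R) x :
  (forall n, c0 (u n - x)) ->
  (forall e' : R, 0 < e' -> \forall n \near \oo, forall l, `|u n l - x l| <= e') ->
  0 < e -> \forall n \near \oo, a (u n - x) i <= e.
Proof.
move=> uxc ux e0; have mR : 0 < (2 ^ i.+1)%:R :> R by rewrite ltr0n.
apply: filterS (ux _ (divr_gt0 e0 mR)) => n h.
apply: le_trans (interp_le_sup hF (m_gt0 i) (uxc n) h) _.
by rewrite mulrC divfK // gt_eqF.
Qed.

(** Uniform convergence makes each interpolation norm of [u n - x] tend to 0, which settles the
    finitely many entries before [k]; the others form the tail. *)
Lemma interp_space_cvg (u : nat -> nat -> R) x :
  (forall n, W (u n)) -> W x ->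
  (forall e : R, 0 < e -> \forall n \near \oo, forall l, `|u n l - x l| <= e) ->
  (forall e : R, 0 < e -> exists k, \forall n \near \oo,
     M (tail k (a (u n - x))) <= e) ->
  forall e : R, 0 < e -> \forall n \near \oo, P (u n - x) <= e.
Proof.
move=> Wu Wx ux utail e e0; have e2 : 0 < e / 2 by rewrite divr_gt0.
have Wd n : W (u n - x) by apply: (subspaceB interp_space_lin).
have [k hk] := utail _ e2.
have : \forall n \near \oo, N (restr 0 k (a (u n - x) - 0)) <= e / 2.
  apply: (fj_restr_cvg0 hN) => // i e' e0'.
  apply: filterS (interp_seq_small i (fun n => (Wd n).1) ux e0') => n.
  by rewrite subr0 norm_interp_seq.
move: hk; apply: filterS2 => n h1; rewrite subr0 => h2.
apply: le_trans (fj_ext_split hN k (Wd n).2) _.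
by rewrite [leRHS]splitr lerD.
Qed.

(** The list [s] holds numerators over the common denominator [d + 1], and [nth] gives 0 beyond its
    end: a countable family, dense among the nonnegative vectors of [c00]. *)
Definition rational_seq s d : nat -> R := fun i => (nth 0%N s i)%:R / d.+1%:R.

Lemma c00_rational s d : c00 (rational_seq s d).
Proof.
apply/c00P; exists (size s) => i si.
by rewrite /rational_seq nth_default // mul0r.
Qed.

Lemma rational_ge0 s d i : 0 <= rational_seq s d i.
Proof. by rewrite divr_ge0. Qed.

Lemma rational_dense (b : nat -> R) (e : R) : c00 b -> (forall i, 0 <= b i) ->
  0 < e -> exists s d, N (rational_seq s d - b) <= e.
Proof.
(* Rounding down costs at most [1 / (d + 1)] in each of [K] coordinates, and [d + 1 > K / e]. *)
move=> /c00P[K bK] b0 e0; pose d := Num.truncn (K%:R / e).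
have dR : 0 < d.+1%:R :> R by [].
pose s := mkseq (fun i => Num.truncn (b i * d.+1%:R)) K.
exists s, d; have hb i : `|rational_seq s d i - b i| <= d.+1%:R^-1.
  have [iK|Ki] := ltnP i K; last first.
    rewrite /rational_seq nth_default ?size_mkseq // mul0r bK // subr0 normr0.
    by rewrite invr_ge0 ltW.
  rewrite /rational_seq nth_mkseq // distrC.
  have bd0 : 0 <= b i * d.+1%:R by rewrite mulr_ge0 // ltW.
  have /andP[h1 h2] := truncn_itv bd0.
  rewrite ger0_norm ?subr_ge0 ?ler_pdivrMr // lerBlDr.
  rewrite -[X in _ <= X + _]mul1r -mulrDl ler_pdivlMr // addrC natr1.
  exact: ltW.
have bc : c00 (rational_seq s d - b).
  by apply: c00D; [exact: c00_rational|rewrite -scaleN1r; apply: c00Z; apply/c00P; exists K].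
rewrite -(@restr_id _ 0 K (_ - _)) => [|i]; last first.
  rewrite leq0n -leqNgt => Ki; rewrite !fctE /rational_seq nth_default ?size_mkseq //.
  by rewrite mul0r bK // subr0.
apply: le_trans (fj_le_coords hN _ _) _.
apply: (@le_trans _ _ (K%:R * d.+1%:R^-1)).
  rewrite -[X in X%:R * _](card_ord K) -sum1_card natr_sum mulr_suml.
  apply: ler_sum => i _; rewrite mul1r; apply: le_trans (hb i).
  by rewrite ler_piMr // fj_unit_le1.
rewrite ler_pdivrMr // mulrC -ler_pdivrMr //.
exact/ltW/truncnS_gt.
Qed.

End interpolation_space.

(** * The renorming *)

Lemma convexity_gap_scale (R : realType) (E : lmodType R) (c : R)
    (p r : E -> R) x y : (forall z, r z = c * p z) ->
  convexity_gap r x y = c ^+ 2 * convexity_gap p x y.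
Proof. by move=> rE; rewrite /convexity_gap !rE; ring. Qed.

Section renorming.
Context {R : realType} {N : (nat -> R) -> R} {F : set (nat -> R)}
  {pF : (nat -> R) -> R}.
Hypothesis hN : figiel_johnson_norm N.
Hypothesis hF : symmetric_lattice_norm F pF.
Implicit Types (x y : nat -> R) (s : seq nat) (i j k n : nat).

Local Notation a := (interp_seq F pF).
Local Notation M := (fj_ext N).
Local Notation bdd := (fj_bounded N).
Local Notation W := (@interp_space R N F pF).
Local Notation P := (@interp_space_norm R N F pF).
Local Notation code := (nat + seq nat * nat * nat)%type.

(* [inl M] codes the norm of the [M] largest coordinates, [inr (s, d, k)] the
   norm of the [k]-th tail of [a x] shifted by a multiple of a rational vector. *)
Definition test_norm (t : code) x : R :=
  match t with
  | inl l => top_norm l x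
  | inr (s, d, k) => M (tail k (a x) + P x *: rational_seq s d)
  end.

(** Bounds for the test norms relative to [P], made positive because they serve as divisors. The 3
    comes from [interp_space_sup]. *)
Definition test_const (t : code) : R :=
  match t with
  | inl l => 3 * l%:R + 1
  | inr (s, d, k) => 1 + N (rational_seq s d)
  end.

Lemma rational_bdd s d : bdd (rational_seq s d : nat -> R).
Proof. exact: (fj_ext_fin hN (c00_rational s d)).1. Qed.

Lemma rational_M s d : M (rational_seq s d) = N (rational_seq s d).
Proof. exact: (fj_ext_fin hN (c00_rational s d)).2. Qed.

Lemma test_const_gt0 t : 0 < test_const t.
Proof.
case: t => [l|[[s d] k]] /=; first by rewrite ltr_wpDl // mulr_ge0.
by rewrite ltr_pwDl // (fj_ge0 hN) //; exact: c00_rational.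
Qed.

Let P0 x : W x -> 0 <= P x.
Proof. by have [+ _ _] := interp_space_semi hN hF; apply. Qed.

Lemma shifted_bdd k s d x : W x -> bdd (tail k (a x) + P x *: rational_seq s d).
Proof.
move=> [xc xb]; apply: (fj_bddD hN); first exact: fj_bounded_tail.
by apply: (fj_bddZ hN); exact: rational_bdd.
Qed.

Lemma shifted_mono k s d (v w : nat -> R) (p r : R) : bdd w ->
  (forall i, 0 <= v i) -> (forall i, v i <= w i) -> 0 <= p -> p <= r ->
  M (tail k v + p *: rational_seq s d) <= M (tail k w + r *: rational_seq s d).
Proof.
move=> wb v0 vw p0 pr.
have [] // := @fj_ext_mono _ _ hN (tail k v + p *: rational_seq s d)
  (tail k w + r *: rational_seq s d).
  apply: (fj_bddD hN); first exact: fj_bounded_tail.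
  by apply: (fj_bddZ hN); exact: rational_bdd.
move=> i; rewrite !fctE; have q0 := rational_ge0 (R := R) s d i.
have h : tail k v i <= tail k w i by rewrite /tail; case: ifP.
have h0 : 0 <= tail k v i by rewrite /tail; case: ifP.
have h1 : p *: rational_seq s d i <= r *: rational_seq s d i :> R by exact: ler_wpM2r.
have h2 : 0 <= p *: rational_seq s d i :> R by exact: mulr_ge0.
by rewrite !ger0_norm ?addr_ge0 ?lerD // ?(le_trans h0 h) ?(le_trans h2 h1).
Qed.

(** For the shifted tails, [a] and [P] are subadditive and all vectors are nonnegative, so
    monotonicity of [M] yields the triangle inequality. *)
Lemma test_norm_semi t : seminorm_on W (test_norm t).
Proof.
case: t => [l|[[s d] k]] /=.
  have [p0 pZ pD] := top_norm_seminorm (R := R) l.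
  by split=> [x [xc _]|r x [xc _]|x y [xc _] [yc _]]; [exact: p0|exact: pZ|exact: pD].
split=> [x Wx|r x Wx|x y Wx Wy].
- exact: (fj_ext_ge0 hN (shifted_bdd k s d Wx)).
- rewrite /=; have -> : tail k (a (r *: x)) + P (r *: x) *: rational_seq s d =
      `|r| *: (tail k (a x) + P x *: rational_seq s d).
    rewrite (interp_spaceZ hN hF r Wx).2 (interp_seqZ hF _ Wx.1) scalerDr scalerA.
    congr (_ + _); apply/funext => i; rewrite /tail !fctE /tail.
    by case: ifP => // _; rewrite scaler0.
  by rewrite (fj_extZ hN _ (shifted_bdd k s d Wx)) normr_id.
have := fj_ext_le_add hN (shifted_bdd k s d Wx) (shifted_bdd k s d Wy).
rewrite addrACA -tailD -scalerDl; apply: le_trans.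
have [Wxy Pxy] := interp_spaceD hN hF Wx Wy.
apply: shifted_mono => //; last exact: P0.
- by apply: (fj_bddD hN); [exact: Wx.2|exact: Wy.2].
- exact: interp_seq_ge0.
by move=> i; exact: (interp_seqD hF i Wx.1 Wy.1).
Qed.

Lemma test_norm_le t x : W x -> test_norm t x <= test_const t * P x.
Proof.
move=> Wx; case: t => [l|[[s d] k]] /=.
  apply: le_trans (top_norm_le l Wx.1) _.
  have := ler_wpM2l (ler0n R l) (interp_space_sup hN hF Wx).
  have := P0 Wx; lra.
have tb := fj_bounded_tail hN k Wx.2.
apply: le_trans (fj_ext_le_add hN tb (fj_bddZ hN _ (rational_bdd s d))) _.
rewrite (fj_extZ hN _ (rational_bdd s d)) rational_M ger0_norm ?P0 //.
rewrite mulrDl mul1r [P x * _]mulrC lerD2r.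
by have [] := fj_ext_mono hN Wx.2 (ler_norm_tail k (a x)).
Qed.

Lemma test_norm_perm t (eps : nat -> bool) (sigma : nat -> nat) x :
  bijective sigma -> W x ->
  test_norm t (fun i => (-1) ^+ eps i * x (sigma i)) <= test_norm t x.
Proof.
move=> sb Wx; have [yc yb] := interp_space_perm hN hF eps sb Wx.
have ay i := interp_seq_perm hF eps i sb Wx.1.
case: t => [l|[[s d] k]] /=.
  apply: top_norm_dom => [|s us sl]; first exact: Wx.1.
  exists (map sigma s); split; last first.
  - rewrite big_map le_eqVlt; apply/orP; left; apply/eqP; apply: eq_bigr => i _.
    by rewrite normrM normrX normrN1 expr1n mul1r.
  - by rewrite size_map.
  by rewrite map_inj_uniq //; exact: bij_inj.
apply: shifted_mono => //.
- exact: Wx.2.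
- exact: interp_seq_ge0.
- exact: (fj_ext_ge0 hN yb).
have [] // := fj_ext_mono hN Wx.2 (v := a (fun i => (-1) ^+ eps i * x (sigma i))) _.
by move=> i; rewrite !norm_interp_seq.
Qed.

(** The codes are enumerated by [unpickle], with 0 at numbers coding nothing; the weight keeps the
    [n]-th term below [2^-n * P x]. *)
Definition renorming_term (n : nat) x : R :=
  if unpickle n is Some t then 2^-1 ^+ n / test_const t * test_norm t x else 0.

Let w_gt0 n t : 0 < 2^-1 ^+ n / test_const t :> R.
Proof. by rewrite divr_gt0 ?test_const_gt0 // exprn_gt0 // invr_gt0. Qed.

Lemma renorming_term_pickle t x :
  renorming_term (pickle t) x = 2^-1 ^+ pickle t / test_const t * test_norm t x.
Proof. by rewrite /renorming_term pickleK. Qed.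

Lemma renorming_term_semi n : seminorm_on W (renorming_term n).
Proof.
rewrite /renorming_term; case: unpickle => [t|]; last first.
  by split=> *; rewrite ?mulr0 ?addr0.
have [p0 pZ pD] := test_norm_semi t.
split=> [x Wx|r x Wx|x y Wx Wy].
- by rewrite mulr_ge0 ?p0 // ltW.
- by rewrite pZ // mulrCA.
by rewrite -mulrDr ler_wpM2l ?pD // ltW.
Qed.

Lemma renorming_term_le n x : W x -> renorming_term n x <= 2^-1 ^+ n * P x.
Proof.
move=> Wx; rewrite /renorming_term; case: unpickle => [t|].
  rewrite -mulrA ler_pM2l ?exprn_gt0 ?invr_gt0 // ler_pdivrMl ?test_const_gt0 //.
  exact: test_norm_le.
by rewrite mulr_ge0 ?P0 // exprn_ge0 // invr_ge0.
Qed.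

Lemma renorming_term_perm n (eps : nat -> bool) (sigma : nat -> nat) x :
  bijective sigma -> W x ->
  renorming_term n (fun i => (-1) ^+ eps i * x (sigma i)) <= renorming_term n x.
Proof.
move=> sb Wx; rewrite /renorming_term; case: unpickle => [t|//].
by apply: ler_wpM2l; [exact: ltW|exact: test_norm_perm].
Qed.

Definition renorming : (nat -> R) -> R :=
  square_sup (range (iota 0)) renorming_term.

Local Notation q := renorming.
Let Wlin := interp_space_lin hN hF.
Let Psemi := interp_space_semi hN hF.

Lemma renorming_semi : seminorm_on W q.
Proof. exact: (weighted_seminorm Wlin Psemi renorming_term_semi renorming_term_le). Qed.

Lemma renorming_le x : W x -> q x <= 2 * P x.
Proof. exact: (weighted_sup_le Psemi renorming_term_semi renorming_term_le). Qed.

Lemma renorming_ge : exists2 C : R, 0 < C & forall x, W x -> P x <= C * q x.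
Proof.
(* For the empty list and [k = 0] the test norm is [P] itself. *)
pose t0 : code := inr ([::], 0%N, 0%N).
exists (2^-1 ^+ pickle t0 / test_const t0)^-1; first by rewrite invr_gt0.
move=> x Wx; rewrite -ler_pdivrMl ?invr_gt0 // invrK.
have := weighted_sup_ge Psemi renorming_term_semi renorming_term_le (pickle t0) Wx.
rewrite renorming_term_pickle; apply: le_trans.
rewrite ler_pM2l // le_eqVlt; apply/orP; left; apply/eqP; congr M.
apply/funext => i; rewrite !fctE /rational_seq nth_nil mul0r scaler0 addr0.
by rewrite /tail.
Qed.

Lemma renorming_tight (u : nat -> nat -> R) t : (forall n, W (u n)) ->
  midpoint_tight q u -> midpoint_tight (test_norm t) u.
Proof.
move=> Wu uq e e0; have w0 := w_gt0 (pickle t) t.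
have [n0 hn0] := weighted_tight Wlin Psemi renorming_term_semi renorming_term_le Wu uq
  (pickle t) (mulr_gt0 (exprn_gt0 2 w0) e0).
exists n0 => m n n0m n0n; have := hn0 m n n0m n0n.
by rewrite (convexity_gap_scale _ _ (renorming_term_pickle t)) ler_pM2l // exprn_gt0.
Qed.

Lemma renorming_norm_on : norm_on W q.
Proof.
have [q0 qZ qD] := renorming_semi.
split=> // x Wx qx; have [C C0 PC] := renorming_ge.
apply/funext => i; apply/eqP; rewrite -normr_le0.
have := PC x Wx; rewrite qx mulr0 => Px.
apply: le_trans (interp_space_coord hN hF i Wx) _.
by rewrite -(mulr0 3) ler_pM2l.
Qed.

Lemma renorming_equivalent : equivalent_norms W P q.
Proof.
have [C C0 PC] := renorming_ge; exists C^-1, 2; split; rewrite ?invr_gt0 // => x Wx.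
by split; [rewrite ler_pdivrMl // PC|exact: renorming_le].
Qed.

Lemma renorming_perm (eps : nat -> bool) (sigma : nat -> nat) x :
  bijective sigma -> W x ->
  q (fun i => (-1) ^+ eps i * x (sigma i)) <= q x.
Proof.
move=> sb Wx; apply: le_of_sqr; [exact: sqrtr_ge0|exact: sqrtr_ge0|].
apply: (square_sup_le initial_nonempty) => [|s As]; first exact: sqr_ge0.
have bx := weighted_bdd Psemi renorming_term_semi renorming_term_le.
apply: le_trans (square_sup_ge bx Wx As).
have Wy := interp_space_perm hN hF eps sb Wx.
apply: ler_sum => i _; have [n0 _ _] := renorming_term_semi i.
apply: lerXn2r; [exact: n0|exact: n0|exact: renorming_term_perm].
Qed.

Lemma renorming_cvg (u : nat -> nat -> R) x : (forall n, W (u n)) -> W x ->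
  (forall e : R, 0 < e -> \forall n \near \oo, P (u n - x) <= e) ->
  norm_cvg q u x.
Proof.
move=> Wu Wx h; apply/cvgr0Pnorm_le => e e0.
apply: filterS (h _ (divr_gt0 e0 (ltr0n _ 2))) => n hn.
have Wd : W (u n - x) by exact: (subspaceB Wlin).
have [q0 _ _] := renorming_semi; rewrite ger0_norm ?q0 //.
apply: le_trans (renorming_le Wd) _; lra.
Qed.

End renorming.

(** * Rotundity and symmetry *)

(** In the unit ball the gap is at most [4 - r^2 = (2 - r) (2 + r)] with
    [r = p (u m + u n) <= 2]. *)
Lemma double_cvg_tight (R : realType) (E : lmodType R) (V : set E) (p : E -> R)
    (u : nat -> E) : linear_subspace V -> seminorm_on V p -> (forall n, V (u n)) ->
  (forall n, p (u n) <= 1) ->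
  p (u mn.1 + u mn.2) @[mn --> (\oo, \oo)] --> (2 : R) -> midpoint_tight p u.
Proof.
move=> Vlin [p0 _ pD] Vu u1 /cvgrPdist_le u2 e e0.
have [[A B] [[n1 _ hA] [n2 _ hB]] hAB] := u2 _ (divr_gt0 e0 (ltr0n _ 4)).
exists (maxn n1 n2) => m n; rewrite !geq_max => /andP[n1m _] /andP[_ n2n].
have /= := hAB (m, n) (conj (hA _ n1m) (hB _ n2n)); rewrite ler_norml => /andP[_ h].
have := pD _ _ (Vu m) (Vu n); have := u1 m; have := u1 n.
have := p0 _ (Vu m); have := p0 _ (Vu n).
have := p0 _ (subspaceD Vlin (Vu m) (Vu n)).
rewrite /convexity_gap; set r := p (u m + u n) in h *.
move=> r0 pn0 pm0 un um pr.
have hn : p (u n) ^+ 2 <= 1 by rewrite expr_le1.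
have hm : p (u m) ^+ 2 <= 1 by rewrite expr_le1.
have : (2 - r) * (2 + r) <= e / 4 * 4.
  by apply: ler_pM; lra.
lra.
Qed.

Section rotundity.
Context {R : realType} {N : (nat -> R) -> R} {F : set (nat -> R)}
  {pF : (nat -> R) -> R}.
Hypothesis hN : figiel_johnson_norm N.
Hypothesis hF : symmetric_lattice_norm F pF.
Implicit Types (x y : nat -> R) (s : seq nat) (i j k n : nat).

Local Notation a := (interp_seq F pF).
Local Notation M := (fj_ext N).
Local Notation bdd := (fj_bounded N).
Local Notation W := (@interp_space R N F pF).
Local Notation P := (@interp_space_norm R N F pF).
Local Notation q := (@renorming R N F pF).

Let Wlin := interp_space_lin hN hF.
Let Psemi := interp_space_semi hN hF.

Lemma interp_space_norm_test (u : nat -> nat -> R) k : (forall n, W (u n)) ->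
  midpoint_tight (@test_norm R N F pF (inr ([::], 0%N, k))) u ->
  forall e : R, 0 < e -> exists n0, forall m n, (n0 <= m)%N -> (n0 <= n)%N ->
    `|M (tail k (a (u m))) - M (tail k (a (u n)))| <= e.
Proof.
move=> Wu tu e e0.
have [n0 hn0] := midpoint_tightP Wlin (test_norm_semi hN hF _) Wu tu e0.
exists n0 => m n n0m n0n; have [+ _] := hn0 m n n0m n0n.
have E x : @test_norm R N F pF (inr ([::], 0%N, k)) x = M (tail k (a x)).
  rewrite /=; congr M; apply/funext => i.
  by rewrite !fctE /rational_seq nth_nil mul0r scaler0 addr0.
by rewrite !E.
Qed.

Lemma tail0 (v : nat -> R) : tail 0 v = v.
Proof. by apply/funext => i. Qed.

(** * Convergence of bounded sequences that are tight for all test norms *)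

Section sequence.
Variable u : nat -> nat -> R.
Hypothesis Wu : forall n, W (u n).
Hypothesis utight : forall t, midpoint_tight (@test_norm R N F pF t) u.
Hypothesis uB : exists B : R, forall n, P (u n) <= B.

Lemma tight_sup_cauchy (e : R) : 0 < e ->
  exists n0, forall m n, (n0 <= m)%N -> (n0 <= n)%N ->
    forall i, `|u m i - u n i| <= e.
Proof.
have [B hB] := uB.
apply: top_norm_cauchy => [n|l|e' e0'].
- exact: (Wu n).1.
- exact: (utight (inl l)).
have [n hn] := interp_space_count hN hF B e0'.
by exists n => m s us; apply: hn.
Qed.

Definition coord_lim : nat -> R := fun i => limn (fun n => u n i).
Local Notation x := coord_lim.

Lemma coord_lim_unif (e : R) : 0 < e ->
  \forall n \near \oo, forall i, `|u n i - x i| <= e.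
Proof.
move=> e0; have e2 : 0 < e / 2 by rewrite divr_gt0.
have [n0 hn0] := tight_sup_cauchy e2.
exists n0 => // n /= n0n i.
have ux : u n i @[n --> \oo] --> x i.
  apply: real_cauchy_limit => e' e0'; have [n1 hn1] := tight_sup_cauchy e0'.
  by exists n1 => k l n1k n1l; exact: hn1.
have /cvgrPdist_le/(_ _ e2)[n1 _ hn1] := ux.
have h1 := hn1 (maxn n0 n1) (leq_maxr _ _).
have h0 := hn0 n (maxn n0 n1) n0n (leq_maxl _ _) i.
rewrite -(subrK (u (maxn n0 n1) i) (u n i)) -addrA.
rewrite (le_trans (ler_normD _ _)) // [leRHS]splitr lerD // distrC.
exact: h1.
Qed.

Lemma coord_lim_c0 : c0 x.
Proof.
apply/c0P => e e0; have e2 : 0 < e / 2 by rewrite divr_gt0.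
have [n _ /(_ n (leqnn n)) hn] := coord_lim_unif e2.
have /c0P/(_ _ e2)[K hK] := (Wu n).1; exists K => i Ki.
rewrite -(subKr (u n i) (x i)) (le_trans (ler_normB _ _)) // [leRHS]splitr.
by rewrite lerD // ?hK.
Qed.

Let ux_c0 n : c0 (u n - x).
Proof.
by apply: c0D; [exact: (Wu n).1|rewrite -scaleN1r; apply: c0Z; exact: coord_lim_c0].
Qed.

Lemma interp_seq_coord_lim i (e : R) : 0 < e ->
  \forall n \near \oo, `|a (u n) i - a x i| <= e.
Proof.
move=> e0.
apply: filterS (interp_seq_small hF i ux_c0 coord_lim_unif e0) => n.
by apply: le_trans; exact: (interp_seq_lip hF i (Wu n).1 coord_lim_c0).
Qed.

(** Each section of [a x] is within 1 of the same section of some [a (u n)], hence of norm at most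
    [B + 1]. *)
Lemma coord_lim_in : W x.
Proof.
split; first exact: coord_lim_c0.
have [B hB] := uB.
have [] // := @fj_ext_le _ N (B + 1) (a x) => K.
have [n _ /(_ n (leqnn n)) hn] := fj_restr_cvg0 hN K interp_seq_coord_lim ltr01.
have -> : restr 0 K (a x) = restr 0 K (a (u n)) + (-1) *: restr 0 K (a (u n) - a x).
  by rewrite -restrZ -restrD scaleN1r opprB addrC subrK.
apply: le_trans (fjD hN (c00_restr _ _ _) (c00Z _ (c00_restr _ _ _))) _.
rewrite (fjZ hN _ (c00_restr _ _ _)) normrN1 mul1r lerD //.
exact: le_trans (le_fj_ext K (Wu n).2) (hB n).
Qed.

Lemma norm_cauchy (e : R) : 0 < e ->
  exists n0, forall m n, (n0 <= m)%N -> (n0 <= n)%N -> `|P (u m) - P (u n)| <= e.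
Proof.
move=> e0; have := interp_space_norm_test Wu (utight (inr ([::], 0%N, 0%N))) e0.
by move=> [n0 hn0]; exists n0 => m n n0m n0n; have := hn0 m n n0m n0n; rewrite !tail0.
Qed.

(** The shift in a test norm is [P (u n) *: c], with a factor depending on [n]. As [P (u n)] tends
    to [G > 0], a rational [c] close to [b / G] makes it almost equal to [b], and the midpoint
    condition for this test norm passes to the shift [b]. *)
Lemma shifted_tight k (b : nat -> R) (e : R) : 0 < limn (fun n => P (u n)) ->
  c00 b -> (forall i, 0 <= b i) -> 0 < e ->
  exists n0, forall m n, (n0 <= m)%N -> (n0 <= n)%N ->
    M (b + tail k (a (u m))) + M (b + tail k (a (u n)))
      - M ((b + tail k (a (u m))) + (b + tail k (a (u n)))) <= e.
Proof.
set G := limn _ => G0 bc b0 e0.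
have add8 (r p p' : R) : r <= p + p' -> p <= e / 8 -> p' <= e / 8 -> r <= e / 4 by lra.
have sum_up (r r' p p' z z' : R) : r <= p + e / 8 -> r' <= p' + e / 8 ->
  z' <= z + e / 4 -> p + p' - z' <= e / 4 -> r + r' - z <= e by lra.
have [bb _] := fj_ext_fin hN bc.
have e16 : 0 < e / 16 by rewrite divr_gt0.
have e4 : 0 < e / 4 by rewrite divr_gt0.
have [s [d hc]] := rational_dense hN (c00Z G^-1 bc)
  (fun i => mulr_ge0 (ltW (eqbRL (invr_gt0 G) G0)) (b0 i)) (divr_gt0 e16 G0).
set c := rational_seq s d in hc.
have cc : c00 c by exact: c00_rational.
have Nc0 := fj_ge0 hN cc.
have Nc1 : 0 < N c + 1 by rewrite ltr_wpDl.
have /cvgrPdist_le/(_ _ (divr_gt0 e16 Nc1))[n1 _ hn1] := real_cauchy_limit norm_cauchy.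
have Dp n : (n1 <= n)%N -> M (P (u n) *: c - b) <= e / 8.
  move=> /hn1 /= h.
  (* Two errors of at most [e / 16]: from [P (u n)] to its limit, and from [c] to [b / G]. *)
  have -> : P (u n) *: c - b = (P (u n) - G) *: c + G *: (c - G^-1 *: b).
    rewrite scalerBr scalerA mulfV ?gt_eqF // scale1r scalerBl.
    by rewrite addrA subrK.
  have c1 : c00 ((P (u n) - G) *: c) by exact: c00Z.
  have c2 : c00 (c - G^-1 *: b) by apply: c00D => //; rewrite -scaleN1r; do 2! apply: c00Z.
  rewrite (fj_ext_fin hN (c00D c1 (c00Z G c2))).2.
  apply: le_trans (fjD hN c1 (c00Z G c2)) _.
  rewrite (fjZ hN _ cc) (fjZ hN _ c2) (gtr0_norm G0).
  have h1 : G * N (c - G^-1 *: b) <= e / 16 by rewrite mulrC -ler_pdivlMr.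
  have h2 : `|P (u n) - G| * N c <= e / 16.
    rewrite distrC; apply: le_trans (ler_wpM2r Nc0 h) _.
    rewrite -mulrA ler_piMr ?(ltW e16) // mulrC ler_pdivrMr // mul1r.
    by rewrite lerDl.
  lra.
have [n2 hn2] := midpoint_tightP Wlin (test_norm_semi hN hF _) Wu
  (utight (inr (s, d, k))) e4.
exists (maxn n1 n2) => m n; rewrite !geq_max => /andP[n1m n2m] /andP[n1n n2n].
have [_] := hn2 m n n2m n2n; rewrite /= -/c.
have cb := rational_bdd hN s d; rewrite -/c in cb.
have Db l : bdd (P (u l) *: c - b).
  by apply: (fj_bddD hN); [exact: fj_bddZ|rewrite -scaleN1r; exact: fj_bddZ].
have vb l : bdd (tail k (a (u l))) by apply: (fj_bounded_tail hN); exact: (Wu l).2.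
have up l : (n1 <= l)%N ->
    M (b + tail k (a (u l))) <= M (tail k (a (u l)) + P (u l) *: c) + e / 8.
  move=> n1l.
  have Nb : bdd (- (P (u l) *: c - b)) by rewrite -scaleN1r; exact: fj_bddZ.
  have := fj_ext_le_add hN (shifted_bdd hN k s d (Wu l)) Nb; rewrite -/c.
  have -> : M (- (P (u l) *: c - b)) = M (P (u l) *: c - b).
    by rewrite -scaleN1r (fj_extZ hN _ (Db l)) normrN1 mul1r.
  rewrite opprB [b - _]addrC addrA addrK [_ + b]addrC.
  have := Dp l n1l; lra.
(* Subadditivity of [a] and [P] bounds the test norm of the sum by the norm of the sum of the
   shifted tails; replacing both shifts by [b] costs [e / 4]. *)
have lo : M (tail k (a (u m + u n)) + P (u m + u n) *: c) <=
    M ((b + tail k (a (u m))) + (b + tail k (a (u n)))) + e / 4.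
  have vmn : bdd (a (u m) + a (u n)) by apply: (fj_bddD hN); [exact: (Wu m).2|exact: (Wu n).2].
  have [Wmn Pmn] := interp_spaceD hN hF (Wu m) (Wu n).
  have := shifted_mono hN k s d vmn (interp_seq_ge0 _)
    (fun i => interp_seqD hF i (Wu m).1 (Wu n).1) (fj_ext_ge0 hN Wmn.2) Pmn.
  rewrite -/c => /le_trans; apply.
  have -> : tail k (a (u m) + a (u n)) + (P (u m) + P (u n)) *: c =
      (b + tail k (a (u m)) + (b + tail k (a (u n)))) +
      ((P (u m) *: c - b) + (P (u n) *: c - b)).
    apply/funext => i; rewrite tailD !fctE.
    rewrite -![_ *: c i]/(_ * c i); ring.
  apply: le_trans (fj_ext_le_add hN _ _) _.
  - by apply: (fj_bddD hN); apply: (fj_bddD hN).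
  - exact: fj_bddD.
  rewrite lerD2l; exact: add8 (fj_ext_le_add hN (Db m) (Db n)) (Dp m n1m) (Dp n n1n).
exact: sum_up (up m n1m) (up n n1n) lo.
Qed.

Lemma tails_unif (e : R) : 0 < e ->
  exists k, \forall n \near \oo, M (tail k (a (u n))) <= e.
Proof.
move=> e0; set G := limn (fun n => P (u n)).
have Pu := real_cauchy_limit norm_cauchy; rewrite -/G in Pu.
have G_ge0 : 0 <= G.
  apply: limr_ge; first by apply/cvg_ex; exists G.
  by near=> n; have [+ _ _] := Psemi; apply.
(* Dividing by [G] requires [G > 0]; if [G = 0], the norms themselves tend to 0 and [k = 0] will
   do. *)
have [G0|] := ltP 0 G.
  apply: (fj_tails_small hN (a := fun n => a (u n)) (al := a x)) => //.
  - by move=> n; exact: (Wu n).2.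
  - by move=> n i; exact: interp_seq_ge0.
  - exact: coord_lim_in.2.
  - exact: interp_seq_coord_lim.
  - by move=> k b e' bc b0 e0'; exact: shifted_tight.
  by move=> k e' e0'; exact: (interp_space_norm_test Wu (utight _) e0').
move=> Gle; have GE : G = 0 by apply/le_anti; rewrite Gle G_ge0.
exists 0%N; have /cvgrPdist_le/(_ _ e0) := Pu; rewrite GE.
apply: filterS => n; rewrite sub0r normrN tail0; apply: le_trans.
exact: ler_norm.
Unshelve. all: by end_near. Qed.

Lemma tight_cvg (e : R) : 0 < e -> \forall n \near \oo, P (u n - x) <= e.
Proof.
apply: (interp_space_cvg hN hF Wu coord_lim_in coord_lim_unif) => {}e e0.
have e2 : 0 < e / 2 by rewrite divr_gt0.
have [k1 hk1] := tails_unif e2.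
have [k2 hk2] := fj_ext_tail hN coord_lim_in.2 e2.
exists (maxn k1 k2); apply: filterS hk1 => n hn.
have h2 := hk2 _ (leq_maxr k1 k2); set k := maxn k1 k2 in h2 *.
have h1 : M (tail k (a (u n))) <= e / 2.
  apply: le_trans hn.
  have [] // := fj_ext_mono hN (fj_bounded_tail hN k1 (Wu n).2) (v := tail k (a (u n))) _ => i.
  rewrite /tail; case: ifP => ki; last by rewrite normr0.
  by rewrite (leq_trans (leq_maxl k1 k2) ki).
have b1 := fj_bounded_tail hN k (Wu n).2.
have b2 := fj_bounded_tail hN k coord_lim_in.2.
(* Entrywise, [a (u n - x) <= a (u n) + a x], so both tails are small together. *)
apply: le_trans (fj_ext_mono hN (fj_bddD hN b1 b2) _).2 _ => [i|].
    rewrite -[X in _ <= `|X|]/(tail k (a (u n)) i + tail k (a x) i) /tail.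
    case: ifP => _; last by rewrite addr0.
    rewrite norm_interp_seq [leRHS]ger0_norm ?addr_ge0 ?interp_seq_ge0 //.
    have := interp_seqD hF i (Wu n).1 (c0Z (-1) coord_lim_c0).
    by rewrite scaleN1r -scaleN1r (interp_seqZ hF _ coord_lim_c0) normrN1 scale1r scaleN1r.
  by apply: le_trans (fj_ext_le_add hN b1 b2) _; rewrite [leRHS]splitr lerD.
Qed.

End sequence.
Lemma renorming_two_rotund : two_rotund W q.
Proof.
move=> u Wu u1 u2.
have qu := double_cvg_tight Wlin (renorming_semi hN hF) Wu u1 u2.
have tu t := renorming_tight hN hF t Wu qu.
have [C C0 PC] := renorming_ge hN hF.
have uB : exists B : R, forall n, P (u n) <= B.
  exists C => n; apply: le_trans (PC _ (Wu n)) _.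
  by rewrite ler_piMr // ltW.
exists (coord_lim u); first exact: coord_lim_in.
by apply: (renorming_cvg hN hF) => // [|e e0]; [exact: coord_lim_in|exact: tight_cvg].
Qed.

(** * The unit vector basis and its symmetry *)

Lemma series_unit (v : nat -> R) n :
  series (fun i => v i *: unit_vec R i) n = restr 0 n v.
Proof.
apply/funext => j; rewrite /series /= fct_sumE /restr /=.
have [jn|nj] := ltnP j n.
  rewrite (bigD1_seq j) ?mem_index_iota ?iota_uniq //= fctE /unit_vec eqxx.
  rewrite [_ *: 1]mulr1 big1 ?addr0 // => i /negPf ij; rewrite fctE.
  by rewrite eq_sym ij scaler0.
rewrite big_nat big1 // => i /andP[_ ilt]; rewrite fctE /unit_vec.
by rewrite gtn_eqF ?scaler0 // (leq_trans ilt nj).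
Qed.

(** The partial sums are initial sections. They converge uniformly since [x] is null, and the tails
    of [a (restr 0 n x - x)] are dominated by those of [a x]. *)
Lemma renorming_expansion x : W x -> expansion W q (unit_vec R) x x.
Proof.
move=> Wx; split=> //.
have Wr n : W (restr 0 n x).
  have [] // := interp_space_dom hN hF (c := 1) (x := restr 0 n x) ler01 Wx.
  by move=> i; rewrite mul1r ler_norm_restr.
have -> : series (fun n => x n *: unit_vec R n) = (fun n => restr 0 n x).
  by apply/funext => n; exact: series_unit.
have dx n i : `|(restr 0 n x - x) i| <= 1 * `|x i|.
  rewrite mul1r -[X in `|X|]/(restr 0 n x i - x i) /restr.
  by case: ifP => _; rewrite ?subrr ?normr0 // sub0r normrN.
apply: (renorming_cvg hN hF Wr Wx).
apply: (interp_space_cvg hN hF Wr Wx) => e e0.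
  have /c0P/(_ _ e0)[K hK] := Wx.1; exists K => // n /= Kn i.
  rewrite /restr /=; have [ilt|ni] := ltnP i n; first by rewrite subrr normr0 ltW.
  by rewrite sub0r normrN hK // (leq_trans Kn).
have [k hk] := fj_ext_tail hN Wx.2 e0.
exists k; apply: filterE => n; apply: le_trans (hk k (leqnn k)).
apply: (fj_ext_mono hN (fj_bounded_tail hN k Wx.2) _).2 => i.
rewrite /tail; case: ifP => // _; rewrite !norm_interp_seq.
by rewrite -[leRHS]mul1r (interp_seq_dom hF i ler01 Wx.1).
Qed.

(** Coordinates are continuous for [q], and the [i]-th coordinate of every partial sum of length
    above [i] is [b i]. *)
Lemma renorming_expansion_unique x (b : nat -> R) :
  expansion W q (unit_vec R) b x -> b = x.
Proof.
move=> [Wx] /cvgr0Pnorm_le bx; apply/funext => i; apply/eqP; rewrite -subr_eq0.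
have [C C0 PC] := renorming_ge hN hF.
have Wr n : W (restr 0 n b).
  rewrite -series_unit /series /=; elim/big_ind : _ => [|y z Wy Wz|j _].
  - exact: Wlin.1.
  - exact: subspaceD.
  by apply: (subspaceZ Wlin); exact: interp_space_unit.
rewrite -normr_le0; apply/ler_addgt0Pr => e e0; rewrite add0r.
have K0 : 0 < 3 * C by rewrite mulr_gt0.
have [n _ hn] := bx _ (divr_gt0 e0 K0).
have := hn (maxn n i.+1) (leq_maxl _ _); rewrite /= series_unit.
set l := maxn n i.+1 => qe.
have Wd : W (restr 0 l b - x) by exact: (subspaceB Wlin).
have := interp_space_coord hN hF i Wd.
rewrite -[X in `|X| <= _]/(restr 0 l b i - x i) {1}/restr /= leq_maxr => h.
apply: le_trans h _; apply: le_trans (ler_wpM2l (ler0n _ 3) (PC _ Wd)) _.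
rewrite mulrA mulrC -ler_pdivlMr //; apply: le_trans qe; exact: ler_norm.
Qed.

Lemma renorming_symmetric : one_symmetric_basis W q (unit_vec R).
Proof.
split.
  split=> [n|x Wx]; first exact: interp_space_unit.
  exists x; split; first exact: renorming_expansion.
  by move=> b /renorming_expansion_unique.
move=> b eps sigma x sb bx; have Wx := bx.1.
have -> := renorming_expansion_unique bx.
exists (fun n => (-1) ^+ eps n * x (sigma n)); last exact: renorming_perm.
by apply: renorming_expansion; exact: interp_space_perm.
Qed.

Lemma interp_space_renorming : has_symmetric_2R_renorming W P.
Proof.
exists q; split.
- exact: renorming_norm_on.
- exact: renorming_equivalent.
- exact: renorming_two_rotund.
exact: renorming_symmetric.
Qed.

(** In any completion, convergence of the defining series means bounded sections and its sum has
    norm [P x], so the renorming of [W] carries over. *)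
Lemma Y_space_renorming (T : completeNormedModType R) (iota : (nat -> R) -> T) :
  is_completion (@c00 R) N iota ->
  let f := fun n : nat => iota (unit_vec R n) in
  let m := fun n : nat => (2 ^ n.+1)%N in
  has_symmetric_2R_renorming (Y_space F pF f m) (Y_norm F pF f m).
Proof.
move=> hT f m.
have YE : Y_space F pF f m = W.
  by apply/seteqP; split=> x [xc h]; split=> //; apply/(cvg_iota_series hN hT).
have PE x : W x -> Y_norm F pF f m x = P x.
  by move=> [_ xb]; exact: (norm_lim_iota_series hN hT xb).
have [p [np [c [C [c0 C0 ep]]] rp bp]] := interp_space_renorming.
rewrite YE; exists p; split=> //; exists c, C; split=> // x Wx.
by rewrite PE //; exact: ep.
Qed.

End rotundity.

Theorem theorem3p7 (R : realType)
    (N : (nat -> R) -> R) (hN : figiel_johnson_norm N)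
    (T : completeNormedModType R) (iota : (nat -> R) -> T)
    (hT : is_completion (@c00 R) N iota) :
  let f := fun n : nat => iota (unit_vec R n) in
  let m := fun n : nat => (2 ^ n.+1)%N in
  has_symmetric_2R_renorming (Y_space (@ell1 R) (@ell1_norm R) f m)
                             (Y_norm (@ell1 R) (@ell1_norm R) f m) /\
  has_symmetric_2R_renorming (Y_space (@lorentz R) (@lorentz_norm R) f m)
                             (Y_norm (@lorentz R) (@lorentz_norm R) f m).
Proof.
split; first exact: (Y_space_renorming hN (ell1_symmetric (R := R)) hT).
exact: (Y_space_renorming hN (lorentz_symmetric (R := R)) hT).
Qed.
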